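(* Let $f\in\mathcal{K}$ have radius of convergence $R>0$ and fulcrum $F$. Assume that $$\lim_{s\uparrow\ln R}\frac{F^{(k)}(s)}{F''(s)^{k/2}}=0\quad\text{for every integer }k\ge3.$$ Then $f$ is Gaussian.
   Context: The class $\mathcal{K}$ consists of non-constant power series $f(z)=\sum_{n\ge0}a_nz^n$ with radius of convergence $R\in(0,+\infty]$, with $a_n\ge 0$ for all $n$ and $a_0>0$. For $t\in(0,R)$, $X_t$ is the random variable with $\mathbf{P}(X_t=n)=a_nt^n/f(t)$, $n\ge0$ (the Khinchin family of $f$). Write $m_f(t)=\mathbf{E}(X_t)$, $\sigma_f^2(t)=\mathbf{V}(X_t)>0$ and $\breve{X}_t=(X_t-m_f(t))/\sigma_f(t)$. $f$ is called Gaussian if $\breve{X}_t$ converges in distribution to a standard normal random variable as $t\uparrow R$ (i.e. $t\to+\infty$ if $R=+\infty$). The fulcrum of $f$ is $F(s)=\ln f(e^s)$ for real $s<\ln R$; one has $F''(s)=\sigma_f^2(e^s)$. *)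

(* Defs.v *)
From Stdlib Require Import Reals.
From Coquelicot Require Import Coquelicot.
Open Scope R_scope.

Definition in_class_K (a : nat -> R) : Prop :=
  (forall n, 0 <= a n) /\ 0 < a 0%nat /\ (exists n, (1 <= n)%nat /\ a n <> 0) /\
  Rbar_lt (Finite 0) (CV_radius a).

Definition f_of (a : nat -> R) (t : R) : R := PSeries a t.

Definition khinchin_prob (a : nat -> R) (t : R) (n : nat) : R :=
  a n * t ^ n / f_of a t.

Definition mean_f (a : nat -> R) (t : R) : R :=
  Series (fun n => INR n * khinchin_prob a t n).

Definition var_f (a : nat -> R) (t : R) : R :=
  Series (fun n => (INR n - mean_f a t) ^ 2 * khinchin_prob a t n).

Definition sigma_f (a : nat -> R) (t : R) : R := sqrt (var_f a t).

Definition normalized_cdf (a : nat -> R) (t x : R) : R :=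
  Series (fun n => if Rle_dec ((INR n - mean_f a t) / sigma_f a t) x
                   then khinchin_prob a t n else 0).

Definition std_normal_cdf (x : R) : R :=
  RInt_gen (fun u => exp (- u ^ 2 / 2) / sqrt (2 * PI))
           (Rbar_locally m_infty) (at_point x).

Definition Rbar_at_left (r : Rbar) : (R -> Prop) -> Prop :=
  match r with
  | Finite r => at_left r
  | p_infty => Rbar_locally p_infty
  | m_infty => Rbar_locally m_infty
  end.

Definition Rbar_ln (r : Rbar) : Rbar :=
  match r with
  | Finite r => Finite (ln r)
  | p_infty => p_infty
  | m_infty => m_infty
  end.

(* f Gaussian: the normalized variables converge in distribution to N(0,1);
   since the normal cdf is continuous, this is pointwise convergence of cdfs. *)
Definition gaussian (a : nat -> R) : Prop :=
  forall x : R,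
    filterlim (fun t => normalized_cdf a t x) (Rbar_at_left (CV_radius a))
              (locally (std_normal_cdf x)).

Definition fulcrum (a : nat -> R) (s : R) : R := ln (f_of a (exp s)).

(* Main.v *)
Require Import Defs.
From Stdlib Require Import Reals Lra Lia.
From Coquelicot Require Import Coquelicot.
Open Scope R_scope.

(** Method of moments. The quantities [F^(k) / F''^(k/2)] are the cumulants of
    the normalized variable, so iterating [psi' = (F' - m) psi] for
    [psi u = exp (- m u) f (exp u)] expresses its [(n+1)]-st moment through lower
    moments and cumulants; when the cumulants of order at least 3 vanish in the
    limit this becomes the recursion [mu_(n+1) = n mu_(n-1)] of the normal
    moments. Taylor expansion then makes the expectation of a trigonometric
    polynomial a function of finitely many moments up to a small error, and
    polynomials in a sine approximate the indicator of a half-line on any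
    bounded interval, the tails being controlled by the second moment. The
    normal law enters through its truncations to [[-M, M]], so that both sides
    of the comparison are instances of one notion of positive linear functional. *)

(** * Convergence of moments implies convergence of distribution functions *)

(** The comparison is quantitative: finitely many moments, known up to a tolerance, pin down a
    distribution function up to a prescribed error. What makes this possible is the slow growth of
    the normal moments: [mu_(2n) / (2n)!] equals [(1/2)^n / n!], so the Taylor remainder of
    [cos (w x + b)] has small expectation for every frequency [w], at an order that depends on [w].
    A sine serves as the variable of the step functions because polynomials in it can be kept in
    [[0, 1]] on the whole line, even where they approximate nothing, whereas a nonconstant
    polynomial in [x] blows up there.

    A functional is a relation between a function and its value, since only some functions are
    integrable; values are postulated for powers and cosines alone. The value on the indicator of a
    half-line is produced separately for each concrete law. *)

Record expectation (E : (R -> R) -> R -> Prop) : Prop := {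
  expectation_ext : forall f g v, (forall x, f x = g x) -> E f v -> E g v;
  expectation_lin : forall a b f g u v, E f u -> E g v ->
    E (fun x => a * f x + b * g x) (a * u + b * v);
  expectation_le : forall f g u v, (forall x, f x <= g x) ->
    E f u -> E g v -> u <= v;
  expectation_pow : forall k, exists v, E (fun x => x ^ k) v;
  expectation_cos : forall w b, exists v, E (fun x => cos (w * x + b)) v }.

Fixpoint normal_moment (n : nat) : R :=
  match n with
  | O => 1
  | S O => 0
  | S (S k) => INR (S k) * normal_moment k
  end.

(** Order 0 is included, so the total mass is only asked to be close to 1; this admits the truncated
    normal laws, which are not renormalized. *)
Definition near_normal (K : nat) (d : R) (E : (R -> R) -> R -> Prop) : Prop :=
  forall k, (k <= K)%nat -> forall v, E (fun x => x ^ k) v ->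
  Rabs (v - normal_moment k) <= d.

(** The second clause compares two functionals with each other, so the normal expectation of [g] is
    never computed. The first clause lets the value on a linear combination be split into the values
    on its terms. *)
Definition moment_determined (g : R -> R) : Prop :=
  (forall E, expectation E -> exists v, E g v) /\
  forall eps, 0 < eps -> exists K d, 0 < d /\
    forall E1 E2 v1 v2, expectation E1 -> expectation E2 ->
    near_normal K d E1 -> near_normal K d E2 ->
    E1 g v1 -> E2 g v2 -> Rabs (v1 - v2) <= eps.

Lemma near_normal_weaken K K' d d' E :
  (K' <= K)%nat -> d <= d' -> near_normal K d E -> near_normal K' d' E.
Proof.
  intros HK Hd H k Hk v Hv.
  apply Rle_trans with d; [|exact Hd].
  apply H; [lia|exact Hv].
Qed.

Lemma expectation_unique E g u v : expectation E -> E g u -> E g v -> u = v.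
Proof.
  intros HE Hu Hv.
  apply Rle_antisym; eapply (expectation_le E HE); eauto; intros; apply Rle_refl.
Qed.

Lemma moment_determined_ext f g :
  (forall x, f x = g x) -> moment_determined f -> moment_determined g.
Proof.
  intros Hfg [H1 H2]; split.
  - intros E HE. destruct (H1 E HE) as [v Hv].
    exists v. now apply (expectation_ext E HE) with f.
  - intros eps Heps. destruct (H2 eps Heps) as (K & d & Hd & H).
    exists K, d. split; [exact Hd|]. intros E1 E2 v1 v2 HE1 HE2 N1 N2 G1 G2.
    apply (H E1 E2); auto.
    + apply (expectation_ext E1 HE1) with g; auto.
    + apply (expectation_ext E2 HE2) with g; auto.
Qed.

Lemma moment_determined_pow k : moment_determined (fun x => x ^ k).
Proof.
  split; [intros E HE; exact (expectation_pow E HE k)|].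
  intros eps Heps. exists k, (eps / 2). split; [lra|].
  intros E1 E2 v1 v2 _ _ N1 N2 G1 G2.
  specialize (N1 k (le_n k) v1 G1). specialize (N2 k (le_n k) v2 G2).
  apply Rabs_le_between in N1, N2. apply Rabs_le_between. lra.
Qed.

Lemma moment_determined_lin a b f g :
  moment_determined f -> moment_determined g ->
  moment_determined (fun x => a * f x + b * g x).
Proof.
  intros [F1 F2] [G1 G2]; split.
  - intros E HE. destruct (F1 E HE) as [u Hu], (G1 E HE) as [v Hv].
    exists (a * u + b * v). now apply (expectation_lin E HE).
  - intros eps Heps.
    assert (Ha := Rabs_pos a). assert (Hb := Rabs_pos b).
    set (e := eps / (Rabs a + Rabs b + 1)).
    assert (He : 0 < e) by (apply Rdiv_lt_0_compat; lra).
    destruct (F2 e He) as (K & d & Hd & HF), (G2 e He) as (K' & d' & Hd' & HG).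
    exists (max K K'), (Rmin d d'). split; [now apply Rmin_glb_lt|].
    intros E1 E2 v1 v2 HE1 HE2 N1 N2 V1 V2.
    destruct (F1 E1 HE1) as [f1 Hf1], (F1 E2 HE2) as [f2 Hf2],
      (G1 E1 HE1) as [g1 Hg1], (G1 E2 HE2) as [g2 Hg2].
    rewrite (expectation_unique E1 _ _ _ HE1 V1
      (expectation_lin E1 HE1 a b f g f1 g1 Hf1 Hg1)).
    rewrite (expectation_unique E2 _ _ _ HE2 V2
      (expectation_lin E2 HE2 a b f g f2 g2 Hf2 Hg2)).
    assert (Af : Rabs (f1 - f2) <= e).
    { apply (HF E1 E2); auto;
        apply near_normal_weaken with (max K K') (Rmin d d'); auto;
        solve [lia|apply Rmin_l]. }
    assert (Ag : Rabs (g1 - g2) <= e).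
    { apply (HG E1 E2); auto;
        apply near_normal_weaken with (max K K') (Rmin d d'); auto;
        solve [lia|apply Rmin_r]. }
    replace (a * f1 + b * g1 - (a * f2 + b * g2))
      with (a * (f1 - f2) + b * (g1 - g2)) by ring.
    eapply Rle_trans; [apply Rabs_triang|]. rewrite !Rabs_mult.
    replace eps with ((Rabs a + Rabs b + 1) * e) by (unfold e; field; lra).
    assert (Rabs a * Rabs (f1 - f2) <= Rabs a * e) by now apply Rmult_le_compat_l.
    assert (Rabs b * Rabs (g1 - g2) <= Rabs b * e) by now apply Rmult_le_compat_l.
    lra.
Qed.

Lemma moment_determined_poly (c : nat -> R) N :
  moment_determined (fun x => sum_f_R0 (fun k => c k * x ^ k) N).
Proof.
  induction N as [|N IH].
  - apply moment_determined_ext with (fun x => c 0%nat * x ^ 0 + 0 * x ^ 0).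
    + intros x; simpl; ring.
    + apply moment_determined_lin; apply moment_determined_pow.
  - apply moment_determined_ext with
      (fun x => 1 * sum_f_R0 (fun k => c k * x ^ k) N + c (S N) * x ^ S N).
    + intros x; rewrite tech5; ring.
    + apply moment_determined_lin; [exact IH|apply moment_determined_pow].
Qed.

(** Both sides are the coefficient of [w ^ (2 n)] in [exp (w ^ 2 / 2)], the moment generating
    function of the normal law. *)
Lemma normal_moment_even_ratio n :
  normal_moment (2 * n) / INR (Factorial.fact (2 * n)) = (/ 2) ^ n / INR (Factorial.fact n).
Proof.
  induction n as [|n IH].
  - simpl; field.
  - replace (2 * S n)%nat with (S (S (2 * n))) by lia.
    cbn [normal_moment]. rewrite !fact_simpl, !mult_INR.
    assert (F1 := INR_fact_lt_0 (2 * n)). assert (F2 := INR_fact_lt_0 n).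
    assert (E : normal_moment (2 * n) = (/ 2) ^ n / INR (Factorial.fact n) * INR (Factorial.fact (2 * n)))
      by (rewrite <- IH; field; lra).
    rewrite E. rewrite !S_INR, mult_INR. simpl pow. simpl (INR 2).
    assert (H := pos_INR n). field. repeat split; nra.
Qed.

Lemma normal_moment_factorial_decay w eps :
  0 < eps -> exists N,
  w ^ (2 * S N) / INR (Factorial.fact (2 * S N)) * normal_moment (2 * S N) <= eps.
Proof.
  intros Heps.
  destruct (cv_speed_pow_fact (w ^ 2 / 2) eps Heps) as [N HN].
  exists N. specialize (HN (S N) ltac:(lia)).
  unfold Rdist in HN. rewrite Rminus_0_r in HN.
  apply Rabs_lt_between in HN.
  replace (w ^ (2 * S N) / INR (Factorial.fact (2 * S N)) * normal_moment (2 * S N))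
    with ((w ^ 2) ^ S N * (normal_moment (2 * S N) / INR (Factorial.fact (2 * S N)))).
  - rewrite normal_moment_even_ratio.
    replace ((w ^ 2) ^ S N * ((/ 2) ^ S N / INR (Factorial.fact (S N))))
      with ((w ^ 2 / 2) ^ S N / INR (Factorial.fact (S N))); [lra|].
    unfold Rdiv. rewrite Rpow_mult_distr. ring.
  - rewrite <- pow_mult. unfold Rdiv. ring.
Qed.

(** Each differentiation advances the phase by a quarter turn, which gives one formula for all
    orders modulo 4. *)
Lemma is_derive_n_cos_shift b n x :
  is_derive_n (fun y => cos (y + b)) n x (cos (x + b + INR n * (PI / 2))).
Proof.
  revert x; induction n as [|n IH]; intros x.
  - simpl. f_equal; ring.
  - change (is_derive (Derive_n (fun y => cos (y + b)) n) x
      (cos (x + b + INR (S n) * (PI / 2)))).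
    apply is_derive_ext with (fun y => cos (y + b + INR n * (PI / 2))).
    { intros y. symmetry. apply is_derive_n_unique, IH. }
    rewrite S_INR.
    replace (x + b + (INR n + 1) * (PI / 2))
      with (PI / 2 + (x + b + INR n * (PI / 2))) by ring.
    assert (Hs := cos_plus (PI/2) (x + b + INR n * (PI / 2))).
    rewrite cos_PI2, sin_PI2 in Hs. rewrite Hs.
    auto_derive; [trivial|ring].
Qed.

(** All derivatives of a cosine are bounded by 1. The expansion stops at the odd degree [2 n + 1],
    so that the remainder has even order: the bound is then a plain power, whose expectation is a
    moment, rather than a power of [Rabs y]. *)
Lemma cos_taylor_bound b n y :
  Rabs (cos (y + b) -
    sum_f_R0 (fun k => cos (b + INR k * (PI / 2)) / INR (Factorial.fact k) * y ^ k) (S (2 * n)))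
  <= y ^ (2 * S n) / INR (Factorial.fact (2 * S n)).
Proof.
  set (f := fun y => cos (y + b)).
  assert (HD : forall k x, Derive_n f k x = cos (x + b + INR k * (PI / 2)))
    by (intros; apply is_derive_n_unique, is_derive_n_cos_shift).
  assert (Hex : forall k x, ex_derive_n f k x).
  { intros k x. destruct k as [|k]; [exact I|].
    eexists. apply (is_derive_n_cos_shift b (S k) x). }
  assert (Hbound : forall z r, 0 <= r -> Rabs (r * cos z) <= r).
  { intros z r Hr. rewrite Rabs_mult, (Rabs_pos_eq r) by exact Hr.
    rewrite <- (Rmult_1_r r) at 2. apply Rmult_le_compat_l; [exact Hr|].
    apply Rabs_le. split; apply COS_bound. }
  assert (Hr : 0 <= y ^ (2 * S n) / INR (Factorial.fact (2 * S n))).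
  { apply Rmult_le_pos; [rewrite pow_mult; apply pow_le; apply pow2_ge_0|].
    left; apply Rinv_0_lt_compat, INR_fact_lt_0. }
  assert (Hsum : forall x m, sum_f_R0 (fun k => x ^ k / INR (Factorial.fact k) * Derive_n f k 0) m
     = sum_f_R0 (fun k => cos (b + INR k * (PI / 2)) / INR (Factorial.fact k) * x ^ k) m).
  { intros x m. apply sum_eq. intros k _. rewrite HD, Rplus_0_l. unfold Rdiv; ring. }
  assert (Hm : S (S (2 * n)) = (2 * S n)%nat) by lia.
  destruct (Rtotal_order y 0) as [Hy|[Hy|Hy]].
  (* [Taylor_Lagrange] expands to the right of the base point; negative [y] is reached by
     reflection, and the signs [(-1) ^ k] recombine with [(- y) ^ k]. *)
  - set (g := fun x => f (- x)).
    assert (HDg : forall k x, Derive_n g k x = (-1) ^ k * Derive_n f k (- x)).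
    { intros k x. unfold g. apply Derive_n_comp_opp.
      exists (mkposreal 1 Rlt_0_1). intros; apply Hex. }
    destruct (Taylor_Lagrange g (S (2 * n)) 0 (- y)) as (z & Hz & Ez); [lra| |].
    { intros t _ k _. destruct k as [|k]; [exact I|].
      apply ex_derive_n_comp_opp. exists (mkposreal 1 Rlt_0_1). intros; apply Hex. }
    unfold g at 1 in Ez. rewrite Ropp_involutive in Ez. fold (f y). rewrite Ez.
    rewrite (sum_eq _ (fun k => cos (b + INR k * (PI / 2)) / INR (Factorial.fact k) * y ^ k)).
    2:{ intros k _. rewrite HDg, HD, Ropp_0, Rplus_0_l, Rminus_0_r.
        replace (- y) with (-1 * y) by ring. rewrite Rpow_mult_distr.
        unfold Rdiv.
        transitivity ((-1 * -1) ^ k * y ^ k * / INR (Factorial.fact k) * cos (b + INR k * (PI * / 2))).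
        rewrite Rpow_mult_distr; ring.
        replace (-1 * -1) with 1 by ring. rewrite pow1; ring. }
    rewrite Hm, HDg, HD, Rminus_0_r.
    match goal with |- Rabs (?s + ?r - ?s') <= _ => replace (s + r - s') with r by ring end.
    replace ((- y) ^ (2 * S n)) with (y ^ (2 * S n))
      by (rewrite !pow_mult; f_equal; ring).
    replace ((-1) ^ (2 * S n)) with 1
      by (rewrite pow_mult; replace ((-1) ^ 2) with 1 by ring; now rewrite pow1).
    rewrite Rmult_1_l. now apply Hbound.
  - subst y. rewrite <- Hsum.
    rewrite (decomp_sum _ (S (2 * n))) by lia.
    rewrite (sum_eq _ (fun _ => 0)).
    2:{ intros k _. simpl pow. unfold Rdiv. ring. }
    rewrite sum_cte, HD. simpl Factorial.fact. simpl INR. rewrite Rplus_0_l.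
    match goal with |- Rabs ?x <= _ => replace x with 0 end.
    + now rewrite Rabs_R0.
    + replace (b + 0 * (PI / 2)) with b by ring. rewrite pow_O. field.
  - destruct (Taylor_Lagrange f (S (2 * n)) 0 y) as (z & Hz & Ez); [lra| |].
    { intros t _ k _. apply Hex. }
    fold (f y). rewrite Ez, !Rminus_0_r, Hsum, Hm, HD.
    match goal with |- Rabs (?s + ?r - ?s') <= _ => replace (s + r - s') with r by ring end.
    now apply Hbound.
Qed.

Lemma moment_determined_cos w b : moment_determined (fun x => cos (w * x + b)).
Proof.
  split; [intros E HE; exact (expectation_cos E HE w b)|].
  intros eps Heps.
  (* Each remainder may cost [eps / 4]: one half for the normal moment itself, the other for the
     deviation [c * d'] of the actual moment from it. The polynomial parts cost another
     [eps / 4]. *)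
  destruct (normal_moment_factorial_decay w (eps / 8)) as [N HN]; [lra|].
  set (p := fun x => sum_f_R0 (fun k =>
    cos (b + INR k * (PI / 2)) / INR (Factorial.fact k) * w ^ k * x ^ k) (S (2 * N))).
  set (c := w ^ (2 * S N) / INR (Factorial.fact (2 * S N))) in *.
  assert (Hc : 0 <= c).
  { apply Rmult_le_pos; [rewrite pow_mult; apply pow_le; apply pow2_ge_0|].
    left; apply Rinv_0_lt_compat, INR_fact_lt_0. }
  assert (Hp : forall x, Rabs (cos (w * x + b) - p x) <= c * x ^ (2 * S N)).
  { intros x. unfold p, c.
    assert (H := cos_taylor_bound b N (w * x)).
    rewrite Rpow_mult_distr in H.
    rewrite (sum_eq _ (fun k => cos (b + INR k * (PI / 2)) /
      INR (Factorial.fact k) * w ^ k * x ^ k)) in H.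
    - unfold Rdiv in *. lra.
    - intros k _. rewrite Rpow_mult_distr. ring. }
  destruct (moment_determined_poly (fun k => cos (b + INR k * (PI / 2)) /
    INR (Factorial.fact k) * w ^ k) (S (2 * N))) as [P1 P2].
  fold p in P1, P2.
  destruct (P2 (eps / 4)) as (K & d & Hd & HP); [lra|].
  (* [c + 1] rather than [c], because [c] vanishes when [w = 0]. *)
  set (d' := eps / (8 * (c + 1))).
  assert (Hd' : 0 < d') by (apply Rdiv_lt_0_compat; lra).
  assert (Hcd : c * d' <= eps / 8).
  { apply Rle_trans with ((c + 1) * d'); [nra|].
    right; unfold d'; field; lra. }
  exists (max K (2 * S N)), (Rmin d d'). split; [now apply Rmin_glb_lt|].
  intros E1 E2 v1 v2 HE1 HE2 N1 N2 V1 V2.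
  destruct (P1 E1 HE1) as [p1 Hp1], (P1 E2 HE2) as [p2 Hp2].
  assert (HP12 : Rabs (p1 - p2) <= eps / 4).
  { apply (HP E1 E2); auto;
      apply near_normal_weaken with (max K (2 * S N)) (Rmin d d'); auto;
      solve [lia|apply Rmin_l]. }
  assert (Hrem : forall E v q, expectation E ->
    near_normal (max K (2 * S N)) (Rmin d d') E ->
    E (fun x => cos (w * x + b)) v -> E p q -> Rabs (v - q) <= eps / 4).
  { intros E v q HE HN' Hv Hq.
    destruct (expectation_pow E HE (2 * S N)) as [m Hm].
    assert (Hmm := HN' (2 * S N)%nat (Nat.le_max_r _ _) m Hm).
    apply Rle_trans with (c * m).
    - assert (L1 := expectation_lin E HE 1 (-1) _ _ _ _ Hv Hq).
      assert (L2 := expectation_lin E HE c 0 _ _ _ _ Hm Hm).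
      assert (L3 := expectation_lin E HE (- c) 0 _ _ _ _ Hm Hm).
      apply Rabs_le. split.
      + assert (- c * m + 0 * m <= 1 * v + -1 * q); [|lra].
        apply (expectation_le E HE _ _ _ _) with (2 := L3) (3 := L1).
        intros x. specialize (Hp x). apply Rabs_le_between in Hp. lra.
      + assert (1 * v + -1 * q <= c * m + 0 * m); [|lra].
        apply (expectation_le E HE _ _ _ _) with (2 := L1) (3 := L2).
        intros x. specialize (Hp x). apply Rabs_le_between in Hp. lra.
    - apply Rabs_le_between in Hmm. assert (Hr := Rmin_r d d').
      assert (c * m <= c * (normal_moment (2 * S N) + d')).
      { apply Rmult_le_compat_l; [exact Hc|]. lra. }
      lra. }
  assert (R1 := Hrem E1 v1 p1 HE1 N1 V1 Hp1).
  assert (R2 := Hrem E2 v2 p2 HE2 N2 V2 Hp2).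
  apply Rabs_le_between in HP12, R1, R2. apply Rabs_le_between. lra.
Qed.

(** Arbitrary real frequencies and phases make sines and constants special cases of the generator.
    Closure under pointwise equality stands in for functional extensionality. *)
Inductive trig_poly : (R -> R) -> Prop :=
| trig_poly_cos w b : trig_poly (fun x => cos (w * x + b))
| trig_poly_lin a b f g : trig_poly f -> trig_poly g ->
    trig_poly (fun x => a * f x + b * g x)
| trig_poly_ext f g : (forall x, f x = g x) -> trig_poly f -> trig_poly g.

Lemma moment_determined_trig_poly f : trig_poly f -> moment_determined f.
Proof.
  induction 1.
  - apply moment_determined_cos.
  - now apply moment_determined_lin.
  - now apply moment_determined_ext with f.
Qed.

Lemma trig_poly_const c : trig_poly (fun _ => c).
Proof.
  apply trig_poly_ext with (fun x => c * cos (0 * x + 0) + 0 * cos (0 * x + 0)).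
  - intros x. replace (0 * x + 0) with 0 by ring. rewrite cos_0. ring.
  - apply trig_poly_lin; apply trig_poly_cos.
Qed.

(** The product-to-sum formula settles two cosines; bilinearity does the rest, by induction on [f]
    and, for [f] a cosine, on [g]. *)
Lemma trig_poly_mult f g : trig_poly f -> trig_poly g -> trig_poly (fun x => f x * g x).
Proof.
  intros Hf Hg. induction Hf as [w b|a b f1 f2 _ IH1 _ IH2|f1 f2 H _ IH].
  - induction Hg as [w' b'|a' b' g1 g2 _ IH1 _ IH2|g1 g2 H _ IH].
    + apply trig_poly_ext with (fun x => / 2 * cos ((w - w') * x + (b - b'))
        + / 2 * cos ((w + w') * x + (b + b'))).
      * intros x.
        replace ((w - w') * x + (b - b')) with ((w * x + b) - (w' * x + b')) by ring.
        replace ((w + w') * x + (b + b')) with ((w * x + b) + (w' * x + b')) by ring.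
        rewrite cos_minus, (cos_plus (w * x + b)). field.
      * apply trig_poly_lin; apply trig_poly_cos.
    + eapply trig_poly_ext; [|exact (trig_poly_lin a' b' _ _ IH1 IH2)].
      intros x; simpl; ring.
    + apply trig_poly_ext with (2 := IH). intros x. now rewrite H.
  - eapply trig_poly_ext; [|exact (trig_poly_lin a b _ _ IH1 IH2)].
    intros x; simpl; ring.
  - apply trig_poly_ext with (2 := IH). intros x. now rewrite H.
Qed.

Lemma trig_poly_pow f n : trig_poly f -> trig_poly (fun x => f x ^ n).
Proof.
  intros Hf. induction n as [|n IH]; simpl.
  - apply trig_poly_const.
  - now apply trig_poly_mult.
Qed.

(** * Step functions as polynomials in a sine *)

Lemma pow_decay q eps : 0 <= q < 1 -> 0 < eps -> exists n, q ^ n <= eps.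
Proof.
  intros Hq Heps.
  destruct (pow_lt_1_zero q) with eps as [n Hn]; auto.
  { rewrite Rabs_pos_eq; lra. }
  exists n. specialize (Hn n (le_n n)). apply Rabs_lt_between in Hn. lra.
Qed.

(* Bernoulli's inequality makes [(1 - s ^ n) ^ (2 ^ n)] a sharp step at
   [s = 1/2]: it is at least [1 - (2 s) ^ n] and at most [1 / (2 s) ^ n]. *)
Lemma step_polynomial_bounds s n : 0 <= s <= 1 ->
  0 <= (1 - s ^ n) ^ (2 ^ n) <= 1 /\
  1 - (2 * s) ^ n <= (1 - s ^ n) ^ (2 ^ n) /\
  (1 - s ^ n) ^ (2 ^ n) * (2 * s) ^ n <= 1.
Proof.
  intros Hs.
  assert (H0 : 0 <= s ^ n) by now apply pow_le.
  assert (H1 : s ^ n <= 1) by (rewrite <- (pow1 n); now apply pow_incr).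
  assert (E : (2 * s) ^ n = INR (2 ^ n) * s ^ n)
    by (rewrite Rpow_mult_distr, pow_INR; reflexivity).
  assert (Hq : 0 <= (1 - s ^ n) ^ (2 ^ n)) by (apply pow_le; lra).
  rewrite E. clear E. revert H0 H1 Hq. generalize (s ^ n) as q. intros q H0 H1 Hq.
  repeat split.
  - exact Hq.
  - apply Rle_trans with (1 ^ (2 ^ n)); [apply pow_incr; lra|rewrite pow1; lra].
  - generalize (2 ^ n)%nat as m. intros m. induction m as [|m IH].
    + simpl; lra.
    + rewrite S_INR. simpl pow.
      assert (Hm := pos_INR m).
      apply Rle_trans with ((1 - q) * (1 - INR m * q)).
      * assert (0 <= INR m * (q * q)) by (apply Rmult_le_pos; nra). lra.
      * apply Rmult_le_compat_l; lra.
  - assert (B : INR (2 ^ n) * q <= (1 + q) ^ (2 ^ n)).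
    { destruct (Req_dec (q) 0) as [Z|Z].
      - rewrite Z, Rmult_0_r. apply pow_le; lra.
      - assert (P := poly (2 ^ n) (q)). lra. }
    apply Rle_trans with ((1 - q) ^ (2 ^ n) * (1 + q) ^ (2 ^ n)).
    + now apply Rmult_le_compat_l.
    + rewrite <- Rpow_mult_distr.
      apply Rle_trans with (1 ^ (2 ^ n)); [apply pow_incr; nra|rewrite pow1; lra].
Qed.

(** The step polynomial is applied to [s x = (1 + sin (w (x - c))) / 2], which passes through its
    threshold [1/2] at [c]. The bounds 0 and 1 hold on the whole line, the approximation only on
    [[-L, L]]. *)
Lemma trig_poly_step c eta eps L : 0 < eta -> 0 < eps -> 0 < L ->
  exists H, trig_poly H /\ (forall x, 0 <= H x <= 1) /\
    (forall x, Rabs x <= L -> x <= c - eta -> 1 - eps <= H x) /\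
    (forall x, Rabs x <= L -> c + eta <= x -> H x <= eps).
Proof.
  intros Heta Heps HL.
  assert (HPI := PI_RGT_0). assert (Hc := Rabs_pos c).
  (* A quarter period has length [L + Rabs c + eta], so [w * (x - c)] stays in the interval where
     sine increases whenever [Rabs x <= L]. *)
  set (w := PI / 2 / (L + Rabs c + eta)).
  assert (Hw : 0 < w) by (apply Rdiv_lt_0_compat; lra).
  assert (Hwb : forall y, 0 <= y <= L + Rabs c + eta -> 0 <= w * y <= PI / 2).
  { intros y Hy. split; [apply Rmult_le_pos; lra|].
    replace (PI / 2) with (w * (L + Rabs c + eta)) by (unfold w; field; lra).
    apply Rmult_le_compat_l; lra. }
  set (s := fun x => (1 + sin (w * (x - c))) / 2).
  assert (Hs : forall x, 0 <= s x <= 1).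
  { intros x. unfold s. assert (B := SIN_bound (w * (x - c))). lra. }
  (* At distance at least [eta] from [c], the number [2 * s x] differs from 1 by at least [k]. *)
  set (k := sin (w * eta)).
  assert (Hk : 0 < k).
  { apply sin_gt_0; [now apply Rmult_lt_0_compat|].
    destruct (Hwb eta); lra. }
  assert (Hk1 : k <= 1) by apply SIN_bound.
  assert (Hsin : forall y, eta <= y <= L + Rabs c -> k <= sin (w * y)).
  { intros y Hy. unfold k. destruct (Hwb eta), (Hwb y); try lra.
    apply sin_incr_1; try lra. apply Rmult_le_compat_l; lra. }
  assert (Hxc : forall x, Rabs x <= L -> Rabs (x - c) <= L + Rabs c).
  { intros x Hx. unfold Rminus. eapply Rle_trans; [apply Rabs_triang|].
    rewrite Rabs_Ropp. lra. }
  destruct (pow_decay (1 - k) eps) as [n1 Hn1]; [lra..|].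
  destruct (pow_decay (/ (1 + k)) eps) as [n2 Hn2]; [|lra|].
  { split; [left; apply Rinv_0_lt_compat; lra|].
    rewrite <- Rinv_1. apply Rinv_lt_contravar; lra. }
  (* One exponent for both sides: on the left the error is at most [(1 - k) ^ n], on the right
     [1 / (1 + k) ^ n]. *)
  set (n := (n1 + n2)%nat).
  assert (Hmono : forall q m l, 0 <= q <= 1 -> q ^ (m + l) <= q ^ m).
  { intros q m l Hq. rewrite pow_add. rewrite <- (Rmult_1_r (q ^ m)) at 2.
    apply Rmult_le_compat_l; [apply pow_le; lra|].
    rewrite <- (pow1 l). apply pow_incr; lra. }
  exists (fun x => (1 - s x ^ n) ^ (2 ^ n)). repeat split.
  - apply trig_poly_pow.
    assert (Ts : trig_poly s).
    { apply trig_poly_ext with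
        (fun x => / 2 * 1 + / 2 * cos (w * x + (- (w * c) - PI / 2))).
      - intros x. unfold s.
        replace (w * x + (- (w * c) - PI / 2)) with (- (PI / 2 - w * (x - c))) by ring.
        rewrite cos_neg, cos_shift. field.
      - apply trig_poly_lin; [apply trig_poly_const|apply trig_poly_cos]. }
    apply trig_poly_ext with (fun x => 1 * 1 + (-1) * s x ^ n); [intros; ring|].
    apply trig_poly_lin; [apply trig_poly_const|now apply trig_poly_pow].
  - apply step_polynomial_bounds, Hs.
  - apply step_polynomial_bounds, Hs.
  - intros x Hx Hle.
    apply Rle_trans with (1 - (2 * s x) ^ n);
      [|apply step_polynomial_bounds, Hs].
    assert (S1 : 0 <= 2 * s x <= 1 - k).
    { split; [destruct (Hs x); lra|]. unfold s.
      specialize (Hxc x Hx). apply Rabs_le_between in Hxc.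
      specialize (Hsin (c - x)).
      replace (w * (x - c)) with (- (w * (c - x))) by ring. rewrite sin_neg. lra. }
    assert ((2 * s x) ^ n <= (1 - k) ^ n) by now apply pow_incr.
    assert ((1 - k) ^ n <= (1 - k) ^ n1) by (apply Hmono; lra).
    lra.
  - intros x Hx Hge.
    destruct (step_polynomial_bounds (s x) n (Hs x)) as (B1 & _ & B2).
    assert (S1 : 1 + k <= 2 * s x).
    { unfold s. specialize (Hxc x Hx). apply Rabs_le_between in Hxc.
      specialize (Hsin (x - c)). lra. }
    assert (S2 : (1 + k) ^ n <= (2 * s x) ^ n) by (apply pow_incr; lra).
    assert (S3 : 0 < (1 + k) ^ n) by (apply pow_lt; lra).
    apply Rle_trans with (/ (1 + k) ^ n).
    + apply Rmult_le_reg_r with ((1 + k) ^ n); [exact S3|].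
      rewrite Rinv_l by lra.
      eapply Rle_trans; [apply Rmult_le_compat_l; [apply B1|exact S2]|exact B2].
    + rewrite <- pow_inv. unfold n. rewrite Nat.add_comm.
      eapply Rle_trans; [apply Hmono|exact Hn2].
      split; [left; apply Rinv_0_lt_compat; lra|].
      rewrite <- Rinv_1. apply Rinv_le_contravar; lra.
Qed.

Definition below (x y : R) : R := if Rle_dec y x then 1 else 0.

Lemma below_bounds x y : 0 <= below x y <= 1.
Proof. unfold below; destruct (Rle_dec y x); lra. Qed.

(* A step function [H] agrees with the indicators up to [eps] on
   [-1/sqrt eps, 1/sqrt eps]; outside, [eps * y ^ 2 >= 1] takes over
   (Chebyshev's inequality). *)
Lemma cdf_comparison x eta eps : 0 < eta -> 0 < eps ->
  exists K d, 0 < d /\ forall E1 E2 p1 p2,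
    expectation E1 -> expectation E2 ->
    near_normal K d E1 -> near_normal K d E2 ->
    E1 (below x) p1 -> E2 (below (x + 2 * eta)) p2 -> p1 <= p2 + eps.
Proof.
  intros Heta Heps.
  (* Passing from [p1] to [h1] and from [h2] to [p2] costs [4 e] each, as the expectation of
     [1 + y ^ 2] is at most 4 when both moments are within 1 of their normal value 1; comparing [h1]
     with [h2] costs one more [e]. The step is centred at [x + eta], midway between the two
     thresholds. *)
  set (e := eps / 9). assert (He : 0 < e) by (unfold e; lra).
  destruct (trig_poly_step (x + eta) eta e (/ sqrt e)) as (H & TH & HB & Hlo & Hhi);
    auto.
  { now apply Rinv_0_lt_compat, sqrt_lt_R0. }
  assert (Hcheb : forall y, Rabs y <= / sqrt e \/ 1 <= e * y ^ 2).
  { intros y. destruct (Rle_lt_dec (Rabs y) (/ sqrt e)) as [Hy|Hy]; [now left|right].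
    assert (Sq : 0 < sqrt e) by now apply sqrt_lt_R0.
    rewrite <- (pow2_abs y), <- (sqrt_sqrt e) by lra.
    replace (sqrt e * sqrt e * Rabs y ^ 2) with ((sqrt e * Rabs y) ^ 2) by ring.
    assert (1 < sqrt e * Rabs y).
    { rewrite <- (Rinv_r (sqrt e)) by lra. now apply Rmult_lt_compat_l. }
    nra. }
  assert (Hup : forall y, below x y <= 1 * H y + e * (1 * y ^ 0 + 1 * y ^ 2)).
  { intros y. specialize (HB y). specialize (Hlo y).
    assert (0 <= e * y ^ 2) by (apply Rmult_le_pos; [lra|apply pow2_ge_0]).
    rewrite pow_O. unfold below. destruct (Rle_dec y x) as [Hy|Hy].
    - destruct (Hcheb y) as [C|C]; [|lra].
      specialize (Hlo C). lra.
    - lra. }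
  assert (Hdn : forall y, H y <= 1 * below (x + 2 * eta) y
    + e * (1 * y ^ 0 + 1 * y ^ 2)).
  { intros y. specialize (HB y). specialize (Hhi y).
    assert (0 <= e * y ^ 2) by (apply Rmult_le_pos; [lra|apply pow2_ge_0]).
    rewrite pow_O. unfold below. destruct (Rle_dec y (x + 2 * eta)) as [Hy|Hy].
    - lra.
    - destruct (Hcheb y) as [C|C]; [|lra].
      specialize (Hhi C). lra. }
  destruct (moment_determined_trig_poly H TH) as [H1 H2].
  destruct (H2 e He) as (K & d & Hd & HH).
  exists (max K 2), (Rmin d 1). split; [apply Rmin_glb_lt; lra|].
  intros E1 E2 p1 p2 HE1 HE2 N1 N2 P1 P2.
  destruct (H1 E1 HE1) as [h1 Hh1], (H1 E2 HE2) as [h2 Hh2].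
  assert (H12 : Rabs (h1 - h2) <= e).
  { apply (HH E1 E2); auto;
      apply near_normal_weaken with (max K 2) (Rmin d 1); auto;
      solve [lia|apply Rmin_l]. }
  assert (Hmom : forall E, expectation E -> near_normal (max K 2) (Rmin d 1) E ->
    exists m, E (fun y => 1 * y ^ 0 + 1 * y ^ 2) m /\ m <= 4).
  { intros E HE HN.
    destruct (expectation_pow E HE 0) as [m0 Hm0], (expectation_pow E HE 2) as [m2 Hm2].
    exists (1 * m0 + 1 * m2). split; [now apply (expectation_lin E HE)|].
    assert (A0 := HN 0%nat ltac:(lia) m0 Hm0). assert (A2 := HN 2%nat ltac:(lia) m2 Hm2).
    apply Rabs_le_between in A0, A2. simpl in A0, A2. assert (Hr := Rmin_r d 1). lra. }
  destruct (Hmom E1 HE1 N1) as (m1 & Hm1 & B1), (Hmom E2 HE2 N2) as (m2 & Hm2 & B2).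
  assert (L1 := expectation_le E1 HE1 _ _ _ _ Hup P1
    (expectation_lin E1 HE1 1 e _ _ _ _ Hh1 Hm1)).
  assert (L2 := expectation_le E2 HE2 _ _ _ _ Hdn Hh2
    (expectation_lin E2 HE2 1 e _ _ _ _ P2 Hm2)).
  apply Rabs_le_between in H12. unfold e in *. nra.
Qed.

(** * The normal law *)

Definition normal_density (x : R) : R := exp (- x ^ 2 / 2) / sqrt (2 * PI).

Definition truncated_normal (M : R) (g : R -> R) (v : R) : Prop :=
  is_RInt (fun x => g x * normal_density x) (- M) M v.

Lemma sqrt_2PI_pos : 0 < sqrt (2 * PI).
Proof. apply sqrt_lt_R0. assert (H := PI_RGT_0). lra. Qed.

Lemma normal_density_pos x : 0 < normal_density x.
Proof. apply Rdiv_lt_0_compat; [apply exp_pos|apply sqrt_2PI_pos]. Qed.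

Lemma normal_density_le_1 x : normal_density x <= 1.
Proof.
  assert (H := sqrt_2PI_pos). unfold normal_density.
  apply Rmult_le_reg_r with (sqrt (2 * PI)); [exact H|].
  replace (exp (- x ^ 2 / 2) / sqrt (2 * PI) * sqrt (2 * PI))
    with (exp (- x ^ 2 / 2)) by (field; lra).
  rewrite Rmult_1_l. apply Rle_trans with 1.
  - rewrite <- exp_0. assert (Hx := pow2_ge_0 x).
    destruct (Rle_lt_or_eq_dec (- x ^ 2 / 2) 0) as [L|L]; [lra| |].
    + left. now apply exp_increasing.
    + rewrite L. lra.
  - rewrite <- sqrt_1. apply sqrt_le_1_alt. assert (P := PI2_1). lra.
Qed.

Lemma is_derive_normal_density x :
  is_derive normal_density x (- x * normal_density x).
Proof.
  unfold normal_density. assert (H := sqrt_2PI_pos).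
  auto_derive; [lra|]. unfold Rdiv. replace (- (x * (x * 1)) * / 2) with (- x ^ 2 * / 2) by ring.
  field. lra.
Qed.

Lemma continuous_normal_density x : continuous normal_density x.
Proof. apply (ex_derive_continuous (V := R_NormedModule)). eexists. apply is_derive_normal_density. Qed.

Lemma ex_RInt_normal_density a b : ex_RInt normal_density a b.
Proof. apply (@ex_RInt_continuous R_CompleteNormedModule). intros; apply continuous_normal_density. Qed.

Lemma expectation_truncated_normal M : 0 <= M -> expectation (truncated_normal M).
Proof.
  intros HM. split; unfold truncated_normal.
  - intros f g v Hfg. apply is_RInt_ext. intros x _. now rewrite Hfg.
  - intros a b f g u v Hu Hv.
    apply is_RInt_ext with (fun x => plus (scal a (f x * normal_density x))
      (scal b (g x * normal_density x))).
    + intros x _. unfold plus, scal; simpl; unfold mult; simpl. ring.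
    + apply (is_RInt_plus (V := R_NormedModule)); now apply (is_RInt_scal (V := R_NormedModule)).
  - intros f g u v Hfg Hu Hv.
    apply (is_RInt_le _ _ (- M) M u v) with (2 := Hu) (3 := Hv); [lra|].
    intros x _. apply Rmult_le_compat_r; [left; apply normal_density_pos|apply Hfg].
  - intros k. apply (@ex_RInt_continuous R_CompleteNormedModule).
    intros x _. apply (continuous_mult (K := R_AbsRing)).
    + apply (ex_derive_continuous (V := R_NormedModule)). auto_derive. trivial.
    + apply continuous_normal_density.
  - intros w b. apply (@ex_RInt_continuous R_CompleteNormedModule).
    intros x _. apply (continuous_mult (K := R_AbsRing)).
    + apply (ex_derive_continuous (V := R_NormedModule)). auto_derive. trivial.
    + apply continuous_normal_density.
Qed.

(** * Decay of the normal density and the Gaussian integral *)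

Lemma exp_pow_INR n y : exp y ^ n = exp (INR n * y).
Proof.
  induction n as [|n IH].
  - simpl. now rewrite Rmult_0_l, exp_0.
  - rewrite S_INR. simpl pow. rewrite IH, <- exp_plus. f_equal; ring.
Qed.

Lemma is_lim_pow_mult_normal_density k :
  is_lim (fun x => x ^ k * normal_density x) p_infty 0.
Proof.
  assert (H := sqrt_2PI_pos).
  (* [exp (x ^ 2 / 2)] is the [n]-th power of [exp (x ^ 2 / (2 n))], hence at least
     [(x ^ 2 / (2 n)) ^ n]. With [n = k + 1] the product is at most [c / x ^ (k + 2)], which is
     below [c / x] for [x > 1]. *)
  set (n := S k). set (c := (2 * INR n) ^ n / sqrt (2 * PI)).
  assert (Hn : 0 < INR n) by (apply lt_0_INR; unfold n; lia).
  assert (Hc : 0 < c).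
  { apply Rdiv_lt_0_compat; [apply pow_lt; lra|exact H]. }
  apply (is_lim_le_le_loc (fun _ => 0) (fun x => c * / x)).
  - exists 1. intros x Hx. split.
    + apply Rmult_le_pos; [apply pow_le; lra|left; apply normal_density_pos].
    + assert (E : (x ^ 2 / (2 * INR n)) ^ n <= exp (x ^ 2 / 2)).
      { replace (x ^ 2 / 2) with (INR n * (x ^ 2 / (2 * INR n))) by (field; lra).
        rewrite <- exp_pow_INR. apply pow_incr. split.
        - apply Rmult_le_pos; [apply pow2_ge_0|left; apply Rinv_0_lt_compat; lra].
        - assert (I := exp_ineq1_le (x ^ 2 / (2 * INR n))). lra. }
      assert (Hd : normal_density x = / exp (x ^ 2 / 2) / sqrt (2 * PI)).
      { unfold normal_density. rewrite <- exp_Ropp. do 2 f_equal. field. }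
      rewrite Hd.
      assert (B : 0 < (x ^ 2 / (2 * INR n)) ^ n).
      { apply pow_lt, Rdiv_lt_0_compat; [apply pow_lt; lra|lra]. }
      assert (B' : / exp (x ^ 2 / 2) <= / (x ^ 2 / (2 * INR n)) ^ n)
        by now apply Rinv_le_contravar.
      assert (Hxk : 0 < x ^ k) by (apply pow_lt; lra).
      apply Rle_trans with (x ^ k * (/ (x ^ 2 / (2 * INR n)) ^ n / sqrt (2 * PI))).
      { apply Rmult_le_compat_l; [lra|]. apply Rmult_le_compat_r; [|exact B'].
        left; now apply Rinv_0_lt_compat. }
      assert (E1 : (x ^ 2 / (2 * INR n)) ^ n = x ^ k * x ^ k * x ^ 2 / (2 * INR n) ^ n).
      { unfold Rdiv. rewrite Rpow_mult_distr, pow_inv, <- pow_mult, <- !pow_add.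
        do 2 f_equal. unfold n; lia. }
      rewrite E1. unfold c.
      assert (0 < (2 * INR n) ^ n) by (apply pow_lt; lra).
      assert (1 <= x ^ k) by (apply pow_R1_Rle; lra).
      apply Rmult_le_reg_r with (x ^ k * x ^ 2 * sqrt (2 * PI) / (2 * INR n) ^ n).
      { apply Rdiv_lt_0_compat; [|assumption]. repeat apply Rmult_lt_0_compat; lra. }
      field_simplify; try (repeat split; lra).
      nra.
  - apply is_lim_const.
  - replace (Finite 0) with (Rbar_mult c 0) by (simpl; f_equal; ring).
    apply is_lim_scal_l.
    apply (is_lim_inv (fun x => x) p_infty p_infty); [apply is_lim_id|discriminate].
Qed.

(** Differentiation under the integral sign cancels the denominator [1 + t ^ 2]; the factor
    [exp (- x ^ 2 / 2)] then comes out and the substitution [v = x t] absorbs the remaining [x]. *)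
Lemma gaussian_parameter_integral x :
  is_derive (fun x => RInt (fun t => exp (- x ^ 2 * (1 + t ^ 2) / 2) / (1 + t ^ 2)) 0 1)
    x (- exp (- x ^ 2 / 2) * RInt (fun v => exp (- v ^ 2 / 2)) 0 x).
Proof.
  assert (Hpos : forall t, 0 < 1 + t ^ 2) by (intros t; assert (H := pow2_ge_0 t); lra).
  set (f := fun x t => exp (- x ^ 2 * (1 + t ^ 2) / 2) / (1 + t ^ 2)).
  assert (HD : forall y t : R, is_derive (fun u => f u t) y
    (- y * exp (- y ^ 2 * (1 + t ^ 2) / 2))).
  { intros y t. unfold f. specialize (Hpos t). auto_derive.
    - trivial.
    - replace (- (y * (y * 1)) * (1 + t * (t * 1)) * / 2)
        with (- y ^ 2 * (1 + t ^ 2) / 2) by (unfold Rdiv; ring).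
      simpl in Hpos |- *. field. lra. }
  evar_last.
  - apply (is_derive_RInt_param f 0 1 x).
    + exists (mkposreal 1 Rlt_0_1). intros y _ t _. eexists; apply HD.
    + intros t _.
      apply continuity_2d_pt_ext with (fun u v => - u * exp (- u ^ 2 * (1 + v ^ 2) / 2)).
      { intros u v. symmetry. apply is_derive_unique, HD. }
      apply continuity_2d_pt_mult.
      { apply continuity_2d_pt_opp, continuity_2d_pt_id1. }
      apply (continuity_1d_2d_pt_comp exp (fun u v => - u ^ 2 * (1 + v ^ 2) / 2)).
      { apply derivable_continuous_pt, derivable_pt_exp. }
      apply continuity_2d_pt_ext with (fun u v => (- (u * u)) * (1 + v * v) * / 2).
      { intros; unfold Rdiv; ring. }
      repeat first [apply continuity_2d_pt_mult|apply continuity_2d_pt_plus|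
        apply continuity_2d_pt_opp|apply continuity_2d_pt_id1|
        apply continuity_2d_pt_id2|apply continuity_2d_pt_const].
    + exists (mkposreal 1 Rlt_0_1). intros y _.
      apply (@ex_RInt_continuous R_CompleteNormedModule). intros t _.
      apply (ex_derive_continuous (V := R_NormedModule)). unfold f. auto_derive.
      specialize (Hpos t). simpl in Hpos. repeat split; lra.
  (* The factor [x] and the argument [x * t + 0] give the integrand the shape of the affine
     substitution [RInt_comp_lin]. *)
  - rewrite (RInt_ext _ (fun t => scal (- exp (- x ^ 2 / 2))
      (scal x (exp (- (x * t + 0) ^ 2 / 2))))).
    + rewrite (RInt_scal (V := R_CompleteNormedModule)
        (fun t => scal x (exp (- (x * t + 0) ^ 2 / 2)))).
      * rewrite (RInt_comp_lin (fun v => exp (- v ^ 2 / 2))).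
        -- unfold scal; simpl; unfold mult; simpl. do 2 f_equal; ring.
        -- apply (@ex_RInt_continuous R_CompleteNormedModule). intros t _.
           apply (ex_derive_continuous (V := R_NormedModule)). auto_derive. trivial.
      * apply (@ex_RInt_continuous R_CompleteNormedModule). intros t _.
        apply (ex_derive_continuous (V := R_NormedModule)). unfold scal; simpl; unfold mult; simpl.
        auto_derive. trivial.
    + intros t _. transitivity (- x * exp (- x ^ 2 * (1 + t ^ 2) / 2));
        [apply is_derive_unique, HD|].
      unfold scal; simpl; unfold mult; simpl.
      replace (- (x * (x * 1)) * (1 + t * (t * 1)) / 2) with
       (- (x * (x * 1)) / 2 + - ((x * t + 0) * ((x * t + 0) * 1)) / 2) by field.
      rewrite exp_plus. ring.
Qed.

(* The classical trick: half the square of [int_0^x exp (-v^2/2) dv] and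
   [int_0^1 exp (-x^2 (1+t^2)/2) / (1+t^2) dt] have opposite derivatives, so
   their sum is [int_0^1 dt / (1+t^2) = PI/4]. *)
Lemma half_gaussian_integral_square x : 0 <= x ->
  (RInt (fun v => exp (- v ^ 2 / 2)) 0 x) ^ 2 / 2 +
  RInt (fun t => exp (- x ^ 2 * (1 + t ^ 2) / 2) / (1 + t ^ 2)) 0 1 = PI / 4.
Proof.
  intros Hx.
  set (I := fun x : R => RInt (fun v => exp (- v ^ 2 / 2)) 0 x : R).
  set (J := fun x : R => RInt (fun t => exp (- x ^ 2 * (1 + t ^ 2) / 2) / (1 + t ^ 2)) 0 1 : R).
  change (I x ^ 2 / 2 + J x = PI / 4).
  assert (Hcont : forall y : R, continuous (fun v => exp (- v ^ 2 / 2)) y).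
  { intros y. apply (ex_derive_continuous (V := R_NormedModule)). auto_derive. trivial. }
  assert (HI : forall y : R, is_derive I y (exp (- y ^ 2 / 2))).
  { intros y. apply (is_derive_RInt (fun v => exp (- v ^ 2 / 2)) I 0 y); [|apply Hcont].
    exists (mkposreal 1 Rlt_0_1). intros z _. apply (RInt_correct (V := R_CompleteNormedModule)).
    apply (@ex_RInt_continuous R_CompleteNormedModule). intros; apply Hcont. }
  assert (H0 : I 0 ^ 2 / 2 + J 0 = PI / 4).
  { unfold I, J. rewrite RInt_point. unfold zero; simpl.
    rewrite (RInt_ext _ (fun t => / (1 + t ^ 2))).
    - rewrite (is_RInt_unique _ 0 1 (minus (atan 1) (atan 0))).
      + rewrite atan_1, atan_0. unfold minus, plus, opp; simpl. field.
      + apply (is_RInt_derive atan (fun t => / (1 + t ^ 2))).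
        * intros t _. apply is_derive_Reals.
          apply derivable_pt_lim_atan.
        * intros t _. apply (ex_derive_continuous (V := R_NormedModule)). auto_derive.
          assert (H := pow2_ge_0 t). simpl in H. lra.
    - intros t _. replace (- (0 * (0 * 1)) * (1 + t * (t * 1)) / 2) with 0 by field.
      rewrite exp_0. unfold Rdiv. now rewrite Rmult_1_l. }
  destruct (Req_dec x 0) as [->|Hx0]; [exact H0|].
  rewrite <- H0. symmetry.
  apply (eq_is_derive (fun y => I y ^ 2 / 2 + J y) 0 x); [|lra].
  intros y _.
  evar_last.
  - apply (is_derive_plus (fun y => I y ^ 2 / 2) J).
    + apply (is_derive_comp (fun z => z ^ 2 / 2) I y (I y)); [|apply HI].
      auto_derive; [trivial|field].
    + apply gaussian_parameter_integral.
  - change (exp (- y ^ 2 / 2) * I y + - exp (- y ^ 2 / 2) * I y = 0). ring.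
Qed.

(** The parameter integral [J x] lies between 0 and [exp (- x ^ 2 / 2)], so it vanishes at infinity,
    while the integral of [exp (- v ^ 2 / 2)] over [[0, x]] is [sqrt (PI / 2 - 2 * J x)]. *)
Lemma is_lim_half_gaussian_integral :
  is_lim (fun x => RInt normal_density 0 x) p_infty (/ 2).
Proof.
  assert (HS := sqrt_2PI_pos). assert (HPI := PI_RGT_0).
  set (J := fun x : R => RInt (fun t => exp (- x ^ 2 * (1 + t ^ 2) / 2) / (1 + t ^ 2)) 0 1 : R).
  assert (Hpos : forall t, 0 < 1 + t ^ 2) by (intros t; assert (H := pow2_ge_0 t); lra).
  assert (HJ : is_lim J p_infty 0).
  { apply (is_lim_le_le_loc (fun _ => 0)
      (fun x => sqrt (2 * PI) * (x ^ 0 * normal_density x))).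
    - exists 0. intros x Hx.
      assert (Hex : ex_RInt (fun t => exp (- x ^ 2 * (1 + t ^ 2) / 2) / (1 + t ^ 2)) 0 1).
      { apply (@ex_RInt_continuous R_CompleteNormedModule). intros t _.
        apply (ex_derive_continuous (V := R_NormedModule)). auto_derive.
        specialize (Hpos t). simpl in Hpos. repeat split; lra. }
      split.
      + apply RInt_ge_0; [lra|exact Hex|]. intros t _.
        left; apply Rdiv_lt_0_compat; [apply exp_pos|apply Hpos].
      + unfold normal_density.
        replace (sqrt (2 * PI) * (x ^ 0 * (exp (- x ^ 2 / 2) / sqrt (2 * PI))))
          with (exp (- x ^ 2 / 2)) by (rewrite pow_O; field; lra).
        replace (exp (- x ^ 2 / 2)) with (RInt (fun _ => exp (- x ^ 2 / 2)) 0 1)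
          by (rewrite RInt_const; unfold scal; simpl; unfold mult; simpl; ring).
        apply RInt_le; [lra|exact Hex|apply ex_RInt_const|]. intros t _.
        apply Rle_trans with (exp (- x ^ 2 * (1 + t ^ 2) / 2)).
        * specialize (Hpos t). assert (Ht := pow2_ge_0 t).
          assert (E := exp_pos (- x ^ 2 * (1 + t ^ 2) / 2)).
          apply Rmult_le_reg_r with (1 + t ^ 2); [exact Hpos|].
          unfold Rdiv at 1. rewrite Rmult_assoc, Rinv_l by lra. nra.
        * assert (Ht := pow2_ge_0 t). assert (Hxx := pow2_ge_0 x).
          assert (0 <= x ^ 2 * t ^ 2) by now apply Rmult_le_pos.
          destruct (Req_dec (x ^ 2 * t ^ 2) 0) as [Z|Z].
          -- right. f_equal. lra.
          -- left. apply exp_increasing. lra.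
    - apply is_lim_const.
    - replace (Finite 0) with (Rbar_mult (sqrt (2 * PI)) 0) by (simpl; f_equal; ring).
      apply is_lim_scal_l, is_lim_pow_mult_normal_density. }
  apply is_lim_ext_loc with (fun x => sqrt (PI / 2 - 2 * J x) / sqrt (2 * PI)).
  { exists 0. intros x Hx.
    assert (Hsq := half_gaussian_integral_square x (Rlt_le _ _ Hx)). fold (J x) in Hsq.
    assert (Hex : ex_RInt (fun v => exp (- v ^ 2 / 2)) 0 x).
    { apply (@ex_RInt_continuous R_CompleteNormedModule). intros t _.
      apply (ex_derive_continuous (V := R_NormedModule)). auto_derive. trivial. }
    rewrite (RInt_ext normal_density
      (fun v => scal (/ sqrt (2 * PI)) (exp (- v ^ 2 / 2)))).
    - rewrite (RInt_scal (V := R_CompleteNormedModule)) by exact Hex.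
      assert (HI : 0 <= RInt (fun v => exp (- v ^ 2 / 2)) 0 x).
      { apply RInt_ge_0; [lra|exact Hex|]. intros; left; apply exp_pos. }
      rewrite <- (sqrt_pow2 _ HI).
      unfold scal; simpl; unfold mult; simpl. unfold Rdiv. rewrite Rmult_comm.
      do 2 f_equal. simpl in Hsq. lra.
    - intros v _. unfold normal_density, scal, Rdiv; simpl; unfold mult; simpl. ring. }
  replace (/ 2) with (sqrt (PI / 2 - 2 * 0) / sqrt (2 * PI)).
  - apply (is_lim_comp_continuous J
      (fun y => sqrt (PI / 2 - 2 * y) / sqrt (2 * PI)) p_infty 0 HJ).
    apply (ex_derive_continuous (V := R_NormedModule)). auto_derive. repeat split; lra.
  - rewrite <- sqrt_div_alt by lra.
    replace ((PI / 2 - 2 * 0) / (2 * PI)) with ((/ 2) ^ 2) by (field; lra).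
    apply sqrt_pow2. lra.
Qed.

Lemma RInt_normal_density_opp x : RInt normal_density (- x) 0 = RInt normal_density 0 x.
Proof.
  assert (H := RInt_comp_lin normal_density (-1) 0 (- x) 0
    (ex_RInt_normal_density _ _)).
  replace (-1 * - x + 0) with x in H by ring.
  replace (-1 * 0 + 0) with 0 in H by ring.
  rewrite <- (opp_RInt_swap normal_density 0 x) in H by apply ex_RInt_normal_density.
  rewrite (RInt_ext _ (fun y => scal (-1) (normal_density y))) in H.
  - rewrite (RInt_scal (V := R_CompleteNormedModule)) in H by apply ex_RInt_normal_density.
    unfold scal, opp in H; simpl in H; unfold mult in H; simpl in H. lra.
  - intros y _. f_equal. unfold normal_density. do 3 f_equal. ring.
Qed.

Lemma is_lim_RInt_normal_density_left x :
  is_lim (fun M => RInt normal_density (- M) x) p_infty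
    (/ 2 + RInt normal_density 0 x).
Proof.
  apply is_lim_ext with
    (fun M => RInt normal_density 0 M + RInt normal_density 0 x).
  - intros M. rewrite <- RInt_normal_density_opp.
    apply (RInt_Chasles normal_density); apply ex_RInt_normal_density.
  - apply is_lim_plus' ; [apply is_lim_half_gaussian_integral|apply is_lim_const].
Qed.

Lemma std_normal_cdf_eq x : std_normal_cdf x = / 2 + RInt normal_density 0 x.
Proof.
  apply (is_RInt_gen_unique (V := R_CompleteNormedModule)).
  intros P HP.
  destruct (is_lim_RInt_normal_density_left x P HP) as [A HA].
  exists (fun a => a < - A) (fun b => b = x).
  - now exists (- A).
  - reflexivity.
  - intros a b Ha ->. exists (RInt normal_density a x). split.
    + apply (RInt_correct (V := R_CompleteNormedModule)), ex_RInt_normal_density.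
    + rewrite <- (Ropp_involutive a). apply HA. lra.
Qed.

(** The density is at most 1. This explicit modulus of continuity absorbs the shifts of the
    threshold in the final squeeze. *)
Lemma std_normal_cdf_increment x h : 0 <= h ->
  std_normal_cdf (x + h) <= std_normal_cdf x + h.
Proof.
  intros Hh. rewrite !std_normal_cdf_eq.
  rewrite <- (RInt_Chasles normal_density 0 x (x + h)) by apply ex_RInt_normal_density.
  assert (H : RInt normal_density x (x + h) <= RInt (fun _ => 1) x (x + h)).
  { apply RInt_le; [lra|apply ex_RInt_normal_density|apply ex_RInt_const|].
    intros; apply normal_density_le_1. }
  rewrite RInt_const in H. unfold plus, scal in *; simpl in *; unfold mult in *; simpl in *.
  lra.
Qed.

Lemma truncated_normal_below M x : - M <= x <= M ->
  truncated_normal M (below x) (RInt normal_density (- M) x).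
Proof.
  intros Hx. unfold truncated_normal.
  replace (RInt normal_density (- M) x)
    with (plus (RInt normal_density (- M) x) 0)
    by (unfold plus; simpl; ring).
  apply (is_RInt_Chasles (V := R_NormedModule) _ _ x).
  - apply is_RInt_ext with normal_density.
    + intros y. rewrite Rmin_left, Rmax_right by lra. intros Hy.
      unfold below. destruct (Rle_dec y x); lra.
    + apply (RInt_correct (V := R_CompleteNormedModule)), ex_RInt_normal_density.
  - apply is_RInt_ext with (fun _ => 0).
    + intros y. rewrite Rmin_left, Rmax_right by lra. intros Hy.
      unfold below. destruct (Rle_dec y x); lra.
    + evar_last; [apply (is_RInt_const (V := R_NormedModule))|].
      unfold scal; simpl; unfold mult; simpl; ring.
Qed.

(** * Moments of the truncated normal law *)

Definition truncated_moment (k : nat) (M : R) : R :=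
  RInt (fun x => x ^ k * normal_density x) (- M) M.

Lemma ex_RInt_pow_mult_normal_density k a b :
  ex_RInt (fun x => x ^ k * normal_density x) a b.
Proof.
  apply (@ex_RInt_continuous R_CompleteNormedModule).
  intros x _. apply (continuous_mult (K := R_AbsRing)).
  - apply (ex_derive_continuous (V := R_NormedModule)). auto_derive. trivial.
  - apply continuous_normal_density.
Qed.

(** Integrate the derivative of [x ^ (k + 1) * normal_density x] over [[-M, M]]; the boundary terms
    vanish as [M] grows, leaving the recursion of [normal_moment]. *)
Lemma truncated_moment_recurrence k M :
  truncated_moment (S (S k)) M = INR (S k) * truncated_moment k M
    - (M ^ S k * normal_density M - (- M) ^ S k * normal_density M).
Proof.
  set (d := fun x => minus (scal (INR (S k)) (x ^ k * normal_density x))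
                           (x ^ S (S k) * normal_density x)).
  assert (H : is_RInt d (- M) M
    (minus (M ^ S k * normal_density M) ((- M) ^ S k * normal_density (- M)))).
  { apply (is_RInt_derive (fun x => x ^ S k * normal_density x)).
    - intros x _. evar_last.
      + apply (is_derive_mult (fun x => x ^ S k) normal_density).
        * apply is_derive_pow, is_derive_id.
        * apply is_derive_normal_density.
        * intros; apply Rmult_comm.
      + unfold d, minus, plus, opp, scal, mult, one; simpl; unfold mult; simpl. ring.
    - intros x _. apply (ex_derive_continuous (V := R_NormedModule)).
      unfold d, minus, plus, opp, scal; simpl; unfold mult; simpl.
      auto_derive. repeat split; eexists; apply is_derive_normal_density. }
  assert (H' : is_RInt d (- M) M
    (minus (scal (INR (S k)) (truncated_moment k M)) (truncated_moment (S (S k)) M))).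
  { apply (is_RInt_minus (V := R_NormedModule)).
    - apply (is_RInt_scal (V := R_NormedModule)).
      apply (RInt_correct (V := R_CompleteNormedModule)), ex_RInt_pow_mult_normal_density.
    - apply (RInt_correct (V := R_CompleteNormedModule)), ex_RInt_pow_mult_normal_density. }
  assert (E := eq_trans (eq_sym (is_RInt_unique _ _ _ _ H)) (is_RInt_unique _ _ _ _ H')).
  replace (normal_density (- M)) with (normal_density M) in E
    by (unfold normal_density; do 3 f_equal; ring).
  unfold minus, plus, opp, scal in E; cbn -[INR pow normal_density truncated_moment] in E.
  unfold mult in E; cbn -[INR pow normal_density truncated_moment] in E.
  lra.
Qed.

Lemma truncated_moment_0 M : truncated_moment 0 M = 2 * RInt normal_density 0 M.
Proof.
  unfold truncated_moment. rewrite (RInt_ext _ normal_density).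
  - rewrite <- (RInt_Chasles normal_density (- M) 0 M) by apply ex_RInt_normal_density.
    rewrite RInt_normal_density_opp. unfold plus; simpl. ring.
  - intros x _. simpl. apply Rmult_1_l.
Qed.

Lemma truncated_moment_1 M : truncated_moment 1 M = 0.
Proof.
  apply is_RInt_unique.
  replace 0 with (minus (- normal_density M) (- normal_density (- M))).
  - apply (is_RInt_derive (fun x => - normal_density x)).
    + intros x _. evar_last.
      * apply (is_derive_opp normal_density), is_derive_normal_density.
      * unfold opp; simpl. ring.
    + intros x _. apply (continuous_mult (K := R_AbsRing)).
      * apply (ex_derive_continuous (V := R_NormedModule)). auto_derive. trivial.
      * apply continuous_normal_density.
  - replace (normal_density (- M)) with (normal_density M)
      by (unfold normal_density; do 3 f_equal; ring).
    unfold minus, plus, opp; simpl. ring.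
Qed.

Lemma is_lim_truncated_moment k :
  is_lim (truncated_moment k) p_infty (normal_moment k).
Proof.
  (* The recurrence has step two, so the induction carries two consecutive orders. *)
  enough (H : is_lim (truncated_moment k) p_infty (normal_moment k) /\
    is_lim (truncated_moment (S k)) p_infty (normal_moment (S k))) by apply H.
  induction k as [|k [IH0 IH1]].
  - split.
    + apply is_lim_ext with (fun M => 2 * RInt normal_density 0 M).
      { intros; symmetry; apply truncated_moment_0. }
      replace (Finite (normal_moment 0)) with (Rbar_mult 2 (/ 2))
        by (simpl; f_equal; field).
      apply is_lim_scal_l, is_lim_half_gaussian_integral.
    + apply is_lim_ext with (fun _ => 0).
      { intros; symmetry; apply truncated_moment_1. }
      apply is_lim_const.
  - split; [exact IH1|].
    apply is_lim_ext with (fun M => INR (S k) * truncated_moment k M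
      - (1 - (-1) ^ S k) * (M ^ S k * normal_density M)).
    { intros M. rewrite truncated_moment_recurrence.
      replace (- M) with (-1 * M) by ring. rewrite Rpow_mult_distr. ring. }
    replace (Finite (normal_moment (S (S k)))) with
      (Finite (INR (S k) * normal_moment k - (1 - (-1) ^ S k) * 0))
      by (f_equal; cbn [normal_moment]; ring).
    apply is_lim_minus'.
    + apply (is_lim_scal_l _ (INR (S k)) p_infty (normal_moment k)), IH0.
    + apply (is_lim_scal_l _ (1 - (-1) ^ S k) p_infty 0), is_lim_pow_mult_normal_density.
Qed.

Lemma near_normal_truncated K d : 0 < d ->
  Rbar_locally p_infty (fun M => near_normal K d (truncated_normal M)).
Proof.
  intros Hd. induction K as [|K IH].
  - assert (H := is_lim_truncated_moment 0).
    apply is_lim_spec in H. generalize (H (mkposreal d Hd)).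
    apply filter_imp. intros M HM k Hk v Hv.
    replace k with 0%nat by lia. replace k with 0%nat in Hv by lia.
    rewrite <- (is_RInt_unique _ _ _ _ Hv). left. apply HM.
  - assert (H := is_lim_truncated_moment (S K)).
    apply is_lim_spec in H. generalize (filter_and _ _ (H (mkposreal d Hd)) IH).
    apply filter_imp. intros M [HM HK] k Hk v Hv.
    destruct (Nat.eq_dec k (S K)) as [->|Hne].
    + rewrite <- (is_RInt_unique _ _ _ _ Hv). left. apply HM.
    + apply (HK k); [lia|exact Hv].
Qed.

(** * Derivatives of the fulcrum and centered moments *)

Definition centered_coeff (a : nat -> R) (m : R) (k n : nat) : R :=
  (INR n - m) ^ k * a n.

(** These are the coefficients of [x] times the derivative of the series; neither differentiation
    nor the shift of indices changes the radius. *)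
Lemma CV_radius_index_mult b :
  CV_radius (fun n => INR n * b n) = CV_radius b.
Proof.
  rewrite <- (CV_radius_derive b), <- (CV_radius_incr_1 (PS_derive b)).
  apply CV_radius_ext. intros [|n]; [simpl; unfold zero; simpl; ring|reflexivity].
Qed.

Lemma PSeries_index_mult b x :
  PSeries (fun n => INR n * b n) x = x * PSeries (PS_derive b) x.
Proof.
  rewrite <- PSeries_incr_1. apply PSeries_ext.
  intros [|n]; [simpl; unfold zero; simpl; ring|reflexivity].
Qed.

Lemma CV_radius_centered_coeff a m k :
  Rbar_le (CV_radius a) (CV_radius (centered_coeff a m k)).
Proof.
  induction k as [|k IH].
  - rewrite (CV_radius_ext (centered_coeff a m 0) a).
    + apply Rbar_le_refl.
    + intros n. unfold centered_coeff. simpl. ring.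
  - apply Rbar_le_trans with (1 := IH). set (b := centered_coeff a m k).
    (* Scaling by [- m] preserves the radius of convergence only for [m <> 0]. *)
    destruct (Req_dec m 0) as [Hm|Hm].
    + rewrite (CV_radius_ext (centered_coeff a m (S k)) (fun n => INR n * b n)).
      * rewrite CV_radius_index_mult. apply Rbar_le_refl.
      * intros n. unfold b, centered_coeff. simpl. rewrite Hm. ring.
    + rewrite (CV_radius_ext (centered_coeff a m (S k))
        (PS_plus (fun n => INR n * b n) (PS_scal (- m) b))).
      * assert (H := CV_radius_plus (fun n => INR n * b n) (PS_scal (- m) b)).
        rewrite CV_radius_index_mult, CV_radius_scal in H by lra.
        replace (Rbar_min (CV_radius b) (CV_radius b)) with (CV_radius b) in H;
          [exact H|].
        destruct (CV_radius b); simpl; try reflexivity. now rewrite Rmin_left by lra.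
      * intros n. unfold PS_plus, PS_scal, b, centered_coeff.
        unfold plus, scal; simpl; unfold mult; simpl. ring.
Qed.

Lemma exp_lt_CV_radius_centered a m k u :
  Rbar_lt (exp u) (CV_radius a) ->
  Rbar_lt (Rabs (exp u)) (CV_radius (centered_coeff a m k)).
Proof.
  intros H. rewrite Rabs_pos_eq by (left; apply exp_pos).
  eapply Rbar_lt_le_trans; [exact H|apply CV_radius_centered_coeff].
Qed.

(** The [k]-th derivative in [u] of [exp (- m u) f (exp u)], the sum of the [a n * exp ((n - m) u)].
    The centre [m] is a constant independent of [u]: identities are differentiated with [m] frozen,
    and only afterwards is [m] set to the mean at the point considered. *)
Definition centered_moment (a : nat -> R) (m : R) (k : nat) (u : R) : R :=
  exp (- m * u) * PSeries (centered_coeff a m k) (exp u).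

Lemma is_derive_centered_moment a m k u :
  Rbar_lt (exp u) (CV_radius a) ->
  is_derive (centered_moment a m k) u (centered_moment a m (S k) u).
Proof.
  intros Hu. set (b := centered_coeff a m k).
  assert (Hb := exp_lt_CV_radius_centered a m k u Hu). fold b in Hb.
  evar_last.
  - apply (is_derive_mult (fun u => exp (- m * u)) (fun u => PSeries b (exp u))).
    + apply (is_derive_comp exp (fun u => - m * u)).
      * apply is_derive_exp.
      * apply (is_derive_scal (fun u => u)), is_derive_id.
    + apply (is_derive_comp (PSeries b) exp).
      * now apply is_derive_PSeries.
      * apply is_derive_exp.
    + intros; apply Rmult_comm.
  - unfold centered_moment.
    rewrite (PSeries_ext (centered_coeff a m (S k))
      (PS_plus (fun n => INR n * b n) (PS_scal (- m) b))).
    + rewrite PSeries_plus.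
      * rewrite PSeries_index_mult, PSeries_scal.
        unfold plus, scal, one; simpl; unfold mult; simpl. fold b. ring.
      * apply CV_radius_inside. now rewrite CV_radius_index_mult.
      * apply (ex_pseries_scal (V := R_NormedModule)); [apply Rmult_comm|now apply CV_radius_inside].
    + intros n. unfold PS_plus, PS_scal, b, centered_coeff.
      unfold plus, scal; simpl; unfold mult; simpl. ring.
Qed.

Lemma is_series_ge_term (u : nat -> R) l k :
  (forall n, 0 <= u n) -> is_series u l -> u k <= l.
Proof.
  intros Hu H. apply is_series_Reals in H.
  apply Rle_trans with (sum_f_R0 u k); [|now apply sum_incr].
  destruct k as [|k]; [apply Rle_refl|].
  rewrite tech5. assert (S := cond_pos_sum u k Hu). lra.
Qed.

Lemma class_K_PSeries_pos a x : in_class_K a -> 0 < x -> Rbar_lt x (CV_radius a) ->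
  0 < PSeries a x.
Proof.
  intros (Ha & Ha0 & _) Hx Hr.
  apply Rlt_le_trans with (a 0%nat * x ^ 0); [simpl; lra|].
  apply (is_series_ge_term (fun n => a n * x ^ n)).
  - intros n. apply Rmult_le_pos; [apply Ha|apply pow_le; lra].
  - apply Series_correct, ex_pseries_R, CV_radius_inside.
    now rewrite Rabs_pos_eq by lra.
Qed.

Lemma PSeries_centered_coeff_0 a m x : PSeries (centered_coeff a m 0) x = PSeries a x.
Proof. apply PSeries_ext. intros n. unfold centered_coeff. simpl. ring. Qed.

Lemma centered_moment_0_pos a m u : in_class_K a -> Rbar_lt (exp u) (CV_radius a) ->
  0 < centered_moment a m 0 u.
Proof.
  intros Ha Hu. apply Rmult_lt_0_compat; [apply exp_pos|].
  rewrite PSeries_centered_coeff_0.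
  apply class_K_PSeries_pos; auto. apply exp_pos.
Qed.

Lemma locally_exp_lt (r : Rbar) u : Rbar_lt (exp u) r ->
  locally u (fun v => Rbar_lt (exp v) r).
Proof.
  intros Hu.
  apply (continuous_exp u (fun y => Rbar_lt y r)).
  exact (open_Rbar_lt' (Finite (exp u)) r Hu).
Qed.

(* The algebra generated by the ratios [f_j / f_0], where [f_j] is the [j]-th
   derivative of [f (exp u)]; it is stable under differentiation, whence
   the smoothness of the fulcrum. *)
Inductive ratio_algebra (a : nat -> R) : (R -> R) -> Prop :=
| ratio_algebra_gen j :
    ratio_algebra a (fun u => centered_moment a 0 j u / centered_moment a 0 0 u)
| ratio_algebra_lin b c f g : ratio_algebra a f -> ratio_algebra a g ->
    ratio_algebra a (fun u => b * f u + c * g u)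
| ratio_algebra_mult f g : ratio_algebra a f -> ratio_algebra a g ->
    ratio_algebra a (fun u => f u * g u).

Lemma ratio_algebra_derive a g : in_class_K a -> ratio_algebra a g ->
  exists g', ratio_algebra a g' /\
    forall u, Rbar_lt (exp u) (CV_radius a) -> is_derive g u (g' u).
Proof.
  intros Ha Hg.
  induction Hg as [j|b c f g _ [f' [Tf Df]] _ [g' [Tg Dg]]
                  |f g Hf [f' [Tf Df]] Hg [g' [Tg Dg]]].
  - set (r := fun j u => centered_moment a 0 j u / centered_moment a 0 0 u).
    exists (fun u => 1 * r (S j) u + (-1) * (r j u * r 1%nat u)). split.
    + apply ratio_algebra_lin; [apply ratio_algebra_gen|].
      apply ratio_algebra_mult; apply ratio_algebra_gen.
    + intros u Hu. assert (P := centered_moment_0_pos a 0 u Ha Hu). evar_last.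
      * apply is_derive_div; [now apply is_derive_centered_moment..|lra].
      * unfold r. field. lra.
  - exists (fun u => b * f' u + c * g' u). split.
    + now apply ratio_algebra_lin.
    + intros u Hu.
      apply (is_derive_plus (fun u => b * f u) (fun u => c * g u));
        apply is_derive_scal; auto.
  - exists (fun u => 1 * (f' u * g u) + 1 * (f u * g' u)). split.
    + apply ratio_algebra_lin; now apply ratio_algebra_mult.
    + intros u Hu. evar_last.
      * apply (is_derive_mult f g); [now apply Df|now apply Dg|].
        intros; apply Rmult_comm.
      * unfold plus, mult; simpl. ring.
Qed.

Lemma is_derive_fulcrum a u : in_class_K a -> Rbar_lt (exp u) (CV_radius a) ->
  is_derive (fulcrum a) u (centered_moment a 0 1 u / centered_moment a 0 0 u).
Proof.
  intros Ha Hu. assert (P := centered_moment_0_pos a 0 u Ha Hu).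
  assert (E : forall v, centered_moment a 0 0 v = f_of a (exp v)).
  { intros v. unfold centered_moment, f_of.
    rewrite PSeries_centered_coeff_0, Ropp_0, Rmult_0_l, exp_0. ring. }
  apply is_derive_ext with (fun v => ln (centered_moment a 0 0 v)).
  { intros v. unfold fulcrum. now rewrite E. }
  evar_last.
  - apply (is_derive_comp ln (centered_moment a 0 0)).
    + now apply is_derive_ln.
    + now apply is_derive_centered_moment.
  - reflexivity.
Qed.

(** Counting starts at order 1: the fulcrum is a logarithm, but its first derivative is the ratio
    [f_1 / f_0]. As [Derive_n] is total, this representation is what supplies actual
    differentiability at every order; it holds only where [exp u] is below the radius, an open
    condition, so it can still be differentiated. *)
Lemma Derive_n_fulcrum_ratio_algebra a n : in_class_K a ->
  exists h, ratio_algebra a h /\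
    forall u, Rbar_lt (exp u) (CV_radius a) -> Derive_n (fulcrum a) (S n) u = h u.
Proof.
  intros Ha. induction n as [|n (h & Th & Eh)].
  - eexists. split; [apply (ratio_algebra_gen a 1)|].
    intros u Hu. now apply is_derive_unique, is_derive_fulcrum.
  - destruct (ratio_algebra_derive a h Ha Th) as (h' & Th' & Dh).
    exists h'. split; [exact Th'|]. intros u Hu.
    change (Derive (Derive_n (fulcrum a) (S n)) u = h' u).
    rewrite (Derive_ext_loc _ h).
    + now apply is_derive_unique, Dh.
    + generalize (locally_exp_lt _ u Hu). apply filter_imp, Eh.
Qed.

Lemma is_derive_Derive_n_fulcrum a n u : in_class_K a ->
  Rbar_lt (exp u) (CV_radius a) ->
  is_derive (Derive_n (fulcrum a) (S n)) u (Derive_n (fulcrum a) (S (S n)) u).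
Proof.
  intros Ha Hu. apply Derive_correct.
  destruct (Derive_n_fulcrum_ratio_algebra a n Ha) as (h & Th & Eh).
  destruct (ratio_algebra_derive a h Ha Th) as (h' & _ & Dh).
  exists (h' u). apply is_derive_ext_loc with h; [|now apply Dh].
  generalize (locally_exp_lt _ u Hu). apply filter_imp.
  intros v Hv. symmetry. now apply Eh.
Qed.

(* If [g], [h] list the successive derivatives of two functions [G], [H], this
   is the [n]-th derivative of [G^(p) * H^(q)], Leibniz's formula without
   binomial coefficients. *)
Fixpoint leibniz (g h : nat -> R) (n p q : nat) : R :=
  match n with
  | O => g p * h q
  | S n => leibniz g h n (S p) q + leibniz g h n p (S q)
  end.

Lemma is_derive_leibniz (g h : nat -> R -> R) u n p q :
  (forall j, is_derive (g j) u (g (S j) u)) ->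
  (forall j, is_derive (h j) u (h (S j) u)) ->
  is_derive (fun v => leibniz (fun j => g j v) (fun j => h j v) n p q) u
    (leibniz (fun j => g j u) (fun j => h j u) (S n) p q).
Proof.
  intros Hg Hh. revert p q. induction n as [|n IH]; intros p q.
  - apply (is_derive_mult (g p) (h q)); auto. intros; apply Rmult_comm.
  - apply (is_derive_plus (fun v => leibniz (fun j => g j v) (fun j => h j v) n (S p) q)
      (fun v => leibniz (fun j => g j v) (fun j => h j v) n p (S q))); apply IH.
Qed.

(** Weights: [g j] counts as a cumulant of order [j + 1] and [h j] as a moment of order [j], so
    every term of the expansion has weight [n + p + q + 1]. Here [s] will be the standard deviation
    and [c] the common mass dividing the moments. *)
Lemma leibniz_homogeneous g h c s n p q : c <> 0 -> s <> 0 ->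
  leibniz (fun j => g j / s ^ S j) (fun j => h j / (c * s ^ j)) n p q
  = leibniz g h n p q / (c * s ^ S (n + p + q)).
Proof.
  intros Hc Hs. revert p q. induction n as [|n IH]; intros p q.
  - cbn [leibniz]. replace (S (0 + p + q)) with (S p + q)%nat by lia.
    rewrite pow_add. field. repeat split; auto; now apply pow_nonzero.
  - cbn [leibniz]. rewrite !IH.
    replace (n + S p + q)%nat with (S n + p + q)%nat by lia.
    replace (n + p + S q)%nat with (S n + p + q)%nat by lia.
    field. split; auto; now apply pow_nonzero.
Qed.

(** Only terms with exactly one derivative on the first factor survive, and there are [n] ways to
    choose it. These are the cumulants of the normal law, all zero but the second. At [n = 0] the
    factor [INR n] makes [pred n] harmless. *)
Lemma leibniz_indicator_1 h n q :
  leibniz (fun j => if Nat.eqb j 1 then 1 else 0) h n 0 q = INR n * h (pred n + q)%nat.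
Proof.
  assert (H2 : forall n p q,
    leibniz (fun j => if Nat.eqb j 1 then 1 else 0) h n (S (S p)) q = 0).
  { clear n q. induction n as [|n IH]; intros p q; cbn [leibniz].
    - simpl; ring.
    - rewrite !IH; ring. }
  assert (H1 : forall n q,
    leibniz (fun j => if Nat.eqb j 1 then 1 else 0) h n 1 q = h (n + q)%nat).
  { clear n q. induction n as [|n IH]; intros q; cbn [leibniz].
    - simpl; ring.
    - rewrite H2, IH, Nat.add_succ_r, Rplus_0_l. reflexivity. }
  revert q. induction n as [|n IH]; intros q; cbn [leibniz].
  - simpl; ring.
  - rewrite H1, IH, S_INR. destruct n as [|n].
    + simpl; ring.
    + replace (pred (S n) + S q)%nat with (S n + q)%nat by (simpl; lia).
      replace (pred (S (S n)) + q)%nat with (S n + q)%nat by (simpl; lia). ring.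
Qed.

(** Convergence of [h j] is asked only up to the largest index that occurs, [n + q], so that the
    lemma fits a strong induction on the order of the moment. *)
Lemma filterlim_leibniz {T} (F : (T -> Prop) -> Prop) {FF : Filter F}
  (g h : nat -> T -> R) (g0 h0 : nat -> R) N :
  (forall j, filterlim (g j) F (locally (g0 j))) ->
  (forall j, (j <= N)%nat -> filterlim (h j) F (locally (h0 j))) ->
  forall n p q, (n + q <= N)%nat ->
  filterlim (fun t => leibniz (fun j => g j t) (fun j => h j t) n p q) F
    (locally (leibniz g0 h0 n p q)).
Proof.
  intros Hg Hh n. induction n as [|n IH]; intros p q Hn; cbn [leibniz].
  - apply (filterlim_comp_2 (G := locally (g0 p)) (H := locally (h0 q)) (g p) (h q) Rmult); auto.
    apply (filterlim_mult (K := R_AbsRing)).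
  - eapply (filterlim_comp_2 _ _ Rplus); [apply IH; lia|apply IH; lia|].
    apply (filterlim_plus (V := R_NormedModule)).
Qed.

Definition shifted_slope (a : nat -> R) (m : R) (j : nat) (u : R) : R :=
  Derive_n (fulcrum a) (S j) u - match j with O => m | S _ => 0 end.

Lemma is_derive_shifted_slope a m j u : in_class_K a ->
  Rbar_lt (exp u) (CV_radius a) ->
  is_derive (shifted_slope a m j) u (shifted_slope a m (S j) u).
Proof.
  intros Ha Hu. evar_last.
  - apply (is_derive_minus (Derive_n (fulcrum a) (S j))
      (fun _ => match j with O => m | S _ => 0 end)).
    + now apply is_derive_Derive_n_fulcrum.
    + apply (is_derive_const (V := R_NormedModule)).
  - reflexivity.
Qed.

(* With [psi u = exp (- m u) f (exp u)], this iterates [psi' = (F' - m) psi]. *)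
Lemma centered_moment_leibniz a m n u : in_class_K a ->
  Rbar_lt (exp u) (CV_radius a) ->
  centered_moment a m (S n) u =
  leibniz (fun j => shifted_slope a m j u) (fun j => centered_moment a m j u) n 0 0.
Proof.
  intros Ha. revert u. induction n as [|n IH]; intros u Hu.
  - cbn [leibniz]. unfold shifted_slope. change (Derive_n (fulcrum a) 1 u)
      with (Derive (fulcrum a) u).
    rewrite (is_derive_unique _ _ _ (is_derive_fulcrum a u Ha Hu)).
    (* In this form the product rule yields [- m] from the exponential and the ratio [f_1 / f_0],
       which is the first derivative of the fulcrum, from the other factor. *)
    assert (E : forall v, centered_moment a m 0 v = exp (- m * v) * centered_moment a 0 0 v).
    { intros v. unfold centered_moment.
      rewrite !PSeries_centered_coeff_0, Ropp_0, Rmult_0_l, exp_0. ring. }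
    rewrite <- (is_derive_unique _ _ _ (is_derive_centered_moment a m 0 u Hu)).
    rewrite (Derive_ext _ _ u E).
    assert (P := centered_moment_0_pos a 0 u Ha Hu).
    apply is_derive_unique. evar_last.
    + apply (is_derive_mult (fun v => exp (- m * v)) (centered_moment a 0 0)).
      * apply (is_derive_comp exp (fun u => - m * u)).
        -- apply is_derive_exp.
        -- apply (is_derive_scal (fun u => u)), is_derive_id.
      * now apply is_derive_centered_moment.
      * intros; apply Rmult_comm.
    + rewrite E. unfold plus, scal, one; simpl; unfold mult; simpl. field. lra.
  - rewrite <- (is_derive_unique _ _ _ (is_derive_centered_moment a m (S n) u Hu)).
    rewrite (Derive_ext_loc _ (fun v => leibniz (fun j => shifted_slope a m j v)
      (fun j => centered_moment a m j v) n 0 0)).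
    + apply is_derive_unique, is_derive_leibniz; intros j.
      * now apply is_derive_shifted_slope.
      * now apply is_derive_centered_moment.
    + generalize (locally_exp_lt _ u Hu). apply filter_imp, IH.
Qed.

(** * The normalized Khinchin variables *)

(** The factor [exp (- m * ln t)] cancels in the quotient, leaving the expectation of
    [(X_t - m) ^ k]. *)
Lemma is_series_centered_moment a m k t : in_class_K a -> 0 < t ->
  Rbar_lt t (CV_radius a) ->
  is_series (fun n => (INR n - m) ^ k * khinchin_prob a t n)
    (centered_moment a m k (ln t) / centered_moment a m 0 (ln t)).
Proof.
  intros Ha Ht Hr.
  assert (P := class_K_PSeries_pos a t Ha Ht Hr).
  assert (H : is_series (fun n => centered_coeff a m k n * t ^ n)
    (PSeries (centered_coeff a m k) t)).
  { apply Series_correct, ex_pseries_R, CV_radius_inside.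
    rewrite <- (exp_ln t Ht) at 1. apply exp_lt_CV_radius_centered.
    now rewrite exp_ln. }
  replace (centered_moment a m k (ln t) / centered_moment a m 0 (ln t))
    with (scal (/ PSeries a t) (PSeries (centered_coeff a m k) t)).
  - apply is_series_ext with
      (fun n => scal (/ PSeries a t) (centered_coeff a m k n * t ^ n)).
    + intros n. unfold khinchin_prob, f_of, centered_coeff.
      unfold scal; simpl; unfold mult; simpl. unfold Rdiv. ring.
    + now apply (is_series_scal (V := R_NormedModule)).
  - unfold centered_moment. rewrite PSeries_centered_coeff_0, exp_ln by exact Ht.
    unfold scal; simpl; unfold mult; simpl.
    assert (Q := exp_pos (- m * ln t)). field. lra.
Qed.

Lemma khinchin_prob_ge0 a t n : in_class_K a -> 0 < t -> Rbar_lt t (CV_radius a) ->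
  0 <= khinchin_prob a t n.
Proof.
  intros Ha Ht Hr. assert (P := class_K_PSeries_pos a t Ha Ht Hr).
  apply Rmult_le_pos; [|left; now apply Rinv_0_lt_compat].
  apply Rmult_le_pos; [apply Ha|apply pow_le; lra].
Qed.

Lemma mean_f_fulcrum a t : in_class_K a -> 0 < t -> Rbar_lt t (CV_radius a) ->
  mean_f a t = Derive (fulcrum a) (ln t).
Proof.
  intros Ha Ht Hr.
  assert (Hu : Rbar_lt (exp (ln t)) (CV_radius a)) by now rewrite exp_ln.
  rewrite (is_derive_unique _ _ _ (is_derive_fulcrum a _ Ha Hu)).
  apply is_series_unique.
  apply is_series_ext with (2 := is_series_centered_moment a 0 1 t Ha Ht Hr).
  intros n. simpl. ring.
Qed.

(** The second derivative of [psi] is [F'' psi + (F' - m) psi'], and the last term vanishes when [m]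
    is the mean. *)
Lemma var_f_fulcrum a t : in_class_K a -> 0 < t -> Rbar_lt t (CV_radius a) ->
  var_f a t = Derive_n (fulcrum a) 2 (ln t).
Proof.
  intros Ha Ht Hr.
  assert (Hu : Rbar_lt (exp (ln t)) (CV_radius a)) by now rewrite exp_ln.
  unfold var_f. rewrite (mean_f_fulcrum a t Ha Ht Hr).
  set (m := Derive (fulcrum a) (ln t)).
  rewrite (is_series_unique _ _ (is_series_centered_moment a m 2 t Ha Ht Hr)).
  assert (P := centered_moment_0_pos a m _ Ha Hu).
  rewrite (centered_moment_leibniz a m 1 _ Ha Hu). cbn [leibniz].
  unfold shifted_slope. change (Derive_n (fulcrum a) 1 (ln t)) with m.
  field. lra.
Qed.

(** Two distinct values carry mass, 0 and some [n >= 1], and at most one of them is the mean. *)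
Lemma var_f_pos a t : in_class_K a -> 0 < t -> Rbar_lt t (CV_radius a) ->
  0 < var_f a t.
Proof.
  intros Ha Ht Hr.
  set (u := fun n => (INR n - mean_f a t) ^ 2 * khinchin_prob a t n).
  assert (H : is_series u (var_f a t)).
  { apply Series_correct. eexists. now apply is_series_centered_moment. }
  assert (Hpos : forall n, 0 <= u n).
  { intros n. apply Rmult_le_pos; [apply pow2_ge_0|now apply khinchin_prob_ge0]. }
  assert (P := class_K_PSeries_pos a t Ha Ht Hr).
  assert (Hterm : forall n, a n <> 0 -> INR n <> mean_f a t -> 0 < u n).
  { intros n Hn Hm. apply Rmult_lt_0_compat.
    - apply pow2_gt_0. lra.
    - apply Rdiv_lt_0_compat; [|exact P].
      apply Rmult_lt_0_compat; [|now apply pow_lt].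
      destruct Ha as [Ha _]. specialize (Ha n). lra. }
  destruct (proj1 (proj2 (proj2 Ha))) as (n & Hn & Han).
  assert (Ha0 := proj1 (proj2 Ha)).
  destruct (Req_dec (INR 0) (mean_f a t)) as [E|E].
  - apply Rlt_le_trans with (2 := is_series_ge_term u _ n Hpos H).
    apply Hterm; [exact Han|]. rewrite <- E. apply not_INR. lia.
  - apply Rlt_le_trans with (2 := is_series_ge_term u _ 0 Hpos H).
    apply Hterm; lra.
Qed.

Lemma sigma_f_pos a t : in_class_K a -> 0 < t -> Rbar_lt t (CV_radius a) ->
  0 < sigma_f a t.
Proof. intros Ha Ht Hr. now apply sqrt_lt_R0, var_f_pos. Qed.

Definition normalized_value (a : nat -> R) (t : R) (n : nat) : R :=
  (INR n - mean_f a t) / sigma_f a t.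

Definition normalized_expectation (a : nat -> R) (t : R) (g : R -> R) (v : R) : Prop :=
  is_series (fun n => g (normalized_value a t n) * khinchin_prob a t n) v.

Definition normalized_moment (a : nat -> R) (k : nat) (t : R) : R :=
  centered_moment a (mean_f a t) k (ln t) /
  (centered_moment a (mean_f a t) 0 (ln t) * sigma_f a t ^ k).

Lemma normalized_expectation_pow a t k : in_class_K a -> 0 < t ->
  Rbar_lt t (CV_radius a) ->
  normalized_expectation a t (fun x => x ^ k) (normalized_moment a k t).
Proof.
  intros Ha Ht Hr. assert (S := sigma_f_pos a t Ha Ht Hr).
  assert (Sk := pow_lt _ k S).
  assert (Hu : Rbar_lt (exp (ln t)) (CV_radius a)) by now rewrite exp_ln.
  assert (P := centered_moment_0_pos a (mean_f a t) _ Ha Hu).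
  apply is_series_ext with (fun n => scal (/ sigma_f a t ^ k)
    ((INR n - mean_f a t) ^ k * khinchin_prob a t n)).
  - intros n. unfold normalized_value, scal; simpl; unfold mult; simpl.
    unfold Rdiv. rewrite Rpow_mult_distr, pow_inv. ring.
  - replace (normalized_moment a k t) with (scal (/ sigma_f a t ^ k)
      (centered_moment a (mean_f a t) k (ln t) /
       centered_moment a (mean_f a t) 0 (ln t))).
    + apply (is_series_scal (V := R_NormedModule)). now apply is_series_centered_moment.
    + unfold normalized_moment, scal; simpl; unfold mult; simpl. field. lra.
Qed.

Lemma normalized_expectation_bounded a t g : in_class_K a -> 0 < t ->
  Rbar_lt t (CV_radius a) -> (forall x, Rabs (g x) <= 1) ->
  exists v, normalized_expectation a t g v.
Proof.
  intros Ha Ht Hr Hg. unfold normalized_expectation.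
  apply (ex_series_le (V := R_CompleteNormedModule) _ (khinchin_prob a t)).
  - intros n. change (Rabs (g (normalized_value a t n) * khinchin_prob a t n)
      <= khinchin_prob a t n).
    assert (P := khinchin_prob_ge0 a t n Ha Ht Hr).
    rewrite Rabs_mult, (Rabs_pos_eq (khinchin_prob a t n)) by exact P.
    rewrite <- (Rmult_1_l (khinchin_prob a t n)) at 2.
    now apply Rmult_le_compat_r.
  - eexists. apply is_series_ext with (2 := is_series_centered_moment a 0 0 t Ha Ht Hr).
    intros n. simpl. ring.
Qed.

Lemma expectation_normalized a t : in_class_K a -> 0 < t ->
  Rbar_lt t (CV_radius a) -> expectation (normalized_expectation a t).
Proof.
  intros Ha Ht Hr. split.
  - intros f g v Hfg. apply is_series_ext. intros n. now rewrite Hfg.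
  - intros b c f g u v Hu Hv.
    apply is_series_ext with (fun n =>
      plus (scal b (f (normalized_value a t n) * khinchin_prob a t n))
           (scal c (g (normalized_value a t n) * khinchin_prob a t n))).
    + intros n. unfold plus, scal; simpl; unfold mult; simpl. ring.
    + apply (is_series_plus (V := R_NormedModule));
        now apply (is_series_scal (V := R_NormedModule)).
  - intros f g u v Hfg Hu Hv.
    apply (is_lim_seq_le (sum_n (fun n => f (normalized_value a t n) * khinchin_prob a t n))
      (sum_n (fun n => g (normalized_value a t n) * khinchin_prob a t n)) u v);
      [|exact Hu|exact Hv].
    intros n. apply sum_n_m_le. intros k.
    apply Rmult_le_compat_r; [now apply khinchin_prob_ge0|apply Hfg].
  - intros k. eexists. now apply normalized_expectation_pow.
  - intros w b. apply normalized_expectation_bounded; auto.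
    intros x. apply Rabs_le. split; apply COS_bound.
Qed.

Lemma normalized_expectation_below a t x : in_class_K a -> 0 < t ->
  Rbar_lt t (CV_radius a) ->
  normalized_expectation a t (below x) (normalized_cdf a t x).
Proof.
  intros Ha Ht Hr.
  destruct (normalized_expectation_bounded a t (below x) Ha Ht Hr) as [v Hv].
  { intros y. apply Rabs_le. assert (B := below_bounds x y). lra. }
  replace (normalized_cdf a t x) with v; [exact Hv|].
  symmetry. apply is_series_unique. apply is_series_ext with (2 := Hv).
  intros n. unfold below, normalized_value.
  destruct (Rle_dec _ x); [apply Rmult_1_l|apply Rmult_0_l].
Qed.

(* The [j]-th entry is the cumulant of order [j + 1] of the normalized variable. *)
Definition normalized_cumulant (a : nat -> R) (j : nat) (t : R) : R :=
  shifted_slope a (mean_f a t) j (ln t) / sigma_f a t ^ S j.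

Lemma normalized_moment_recurrence a n t : in_class_K a -> 0 < t ->
  Rbar_lt t (CV_radius a) ->
  normalized_moment a (S n) t =
  leibniz (fun j => normalized_cumulant a j t) (fun j => normalized_moment a j t) n 0 0.
Proof.
  intros Ha Ht Hr.
  assert (Hu : Rbar_lt (exp (ln t)) (CV_radius a)) by now rewrite exp_ln.
  assert (P := centered_moment_0_pos a (mean_f a t) _ Ha Hu).
  assert (S := sigma_f_pos a t Ha Ht Hr).
  unfold normalized_moment at 1. rewrite centered_moment_leibniz by assumption.
  unfold normalized_cumulant, normalized_moment.
  rewrite leibniz_homogeneous by lra. now rewrite !Nat.add_0_r.
Qed.

(** * Passage to the limit at the radius of convergence *)

Lemma Rbar_at_left_filter r : Filter (Rbar_at_left r).
Proof.
  destruct r as [r| |]; simpl.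
  - apply within_filter, locally_filter.
  - apply (Rbar_locally_filter p_infty).
  - apply (Rbar_locally_filter m_infty).
Qed.

Lemma Rbar_at_left_inside (r : Rbar) : Rbar_lt 0 r ->
  Rbar_at_left r (fun t => 0 < t /\ Rbar_lt t r).
Proof.
  destruct r as [r| |]; simpl; intros Hr; [|now exists 0|contradiction].
  exists (mkposreal r Hr). intros y Hy Hlt. split; [|exact Hlt].
  apply Rabs_lt_between' in Hy. simpl in Hy. lra.
Qed.

Lemma filterlim_ln_Rbar_at_left (r : Rbar) : Rbar_lt 0 r ->
  filterlim ln (Rbar_at_left r) (Rbar_at_left (Rbar_ln r)).
Proof.
  destruct r as [r| |]; simpl; intros Hr; [| |contradiction].
  - intros P HP. unfold filtermap.
    assert (C : continuous ln r).
    { apply (ex_derive_continuous (V := R_NormedModule)). eexists.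
      now apply is_derive_ln. }
    assert (H1 := C _ HP). unfold filtermap in H1.
    assert (H2 : locally r (fun y => 0 < y)).
    { exact (open_gt 0 r Hr). }
    unfold at_left, within. generalize (filter_and _ _ H1 H2).
    apply filter_imp. intros y [Hy Hy0] Hlt. apply Hy. now apply ln_increasing.
  - apply is_lim_ln_p.
Qed.

Lemma Rpower_half_INR x k : 0 < x -> Rpower x (INR k / 2) = sqrt x ^ k.
Proof.
  intros Hx. rewrite <- (Rpower_pow k) by now apply sqrt_lt_R0.
  rewrite <- Rpower_sqrt by exact Hx. rewrite Rpower_mult. f_equal. field.
Qed.

(** Centring and scaling make the cumulants of order 1 and 2 exactly 0 and 1 inside the disc; from
    order 3 on, the hypothesis is transported by [s = ln t]. *)
Lemma filterlim_normalized_cumulant a :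
  in_class_K a ->
  (forall k : nat, (3 <= k)%nat ->
     filterlim
       (fun s => Derive_n (fulcrum a) k s /
                 Rpower (Derive_n (fulcrum a) 2 s) (INR k / 2))
       (Rbar_at_left (Rbar_ln (CV_radius a))) (locally 0)) ->
  forall j, filterlim (normalized_cumulant a j) (Rbar_at_left (CV_radius a))
    (locally (if Nat.eqb j 1 then 1 else 0)).
Proof.
  intros Ha H j. assert (HF := Rbar_at_left_filter (CV_radius a)).
  assert (Hin := Rbar_at_left_inside _ (proj2 (proj2 (proj2 Ha)))).
  destruct j as [|[|j]]; cbn [Nat.eqb].
  - apply filterlim_ext_loc with (fun _ => 0); [|apply filterlim_const].
    revert Hin. apply filter_imp. intros t [Ht Hr].
    unfold normalized_cumulant, shifted_slope.
    change (Derive_n (fulcrum a) 1 (ln t)) with (Derive (fulcrum a) (ln t)).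
    rewrite <- mean_f_fulcrum by assumption. unfold Rdiv. ring.
  - apply filterlim_ext_loc with (fun _ => 1); [|apply filterlim_const].
    revert Hin. apply filter_imp. intros t [Ht Hr].
    unfold normalized_cumulant, shifted_slope.
    rewrite <- var_f_fulcrum by assumption. unfold sigma_f.
    assert (V := var_f_pos a t Ha Ht Hr). rewrite pow2_sqrt by lra. field. lra.
  - apply filterlim_ext_loc with (fun t => Derive_n (fulcrum a) (S (S (S j))) (ln t) /
      Rpower (Derive_n (fulcrum a) 2 (ln t)) (INR (S (S (S j))) / 2)).
    + revert Hin. apply filter_imp. intros t [Ht Hr].
      unfold normalized_cumulant, shifted_slope.
      rewrite <- var_f_fulcrum by assumption.
      rewrite Rpower_half_INR by now apply var_f_pos.
      now rewrite Rminus_0_r.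
    + apply (filterlim_comp _ _ _ ln (fun s => Derive_n (fulcrum a) (S (S (S j))) s /
        Rpower (Derive_n (fulcrum a) 2 s) (INR (S (S (S j))) / 2)) _ _ _
        (filterlim_ln_Rbar_at_left _ (proj2 (proj2 (proj2 Ha))))).
      apply H. lia.
Qed.

(** The recurrence expresses order [k + 1] through moments of order at most [k], whence a strong
    induction; inserting the limiting cumulants turns it into the recursion of [normal_moment]. *)
Lemma filterlim_normalized_moment a :
  in_class_K a ->
  (forall j, filterlim (normalized_cumulant a j) (Rbar_at_left (CV_radius a))
    (locally (if Nat.eqb j 1 then 1 else 0))) ->
  forall k, filterlim (normalized_moment a k) (Rbar_at_left (CV_radius a))
    (locally (normal_moment k)).
Proof.
  intros Ha H k. assert (HF := Rbar_at_left_filter (CV_radius a)).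
  assert (Hin := Rbar_at_left_inside _ (proj2 (proj2 (proj2 Ha)))).
  induction k as [[|k] IH] using (well_founded_induction Wf_nat.lt_wf).
  - apply filterlim_ext_loc with (fun _ => 1); [|apply filterlim_const].
    revert Hin. apply filter_imp. intros t [Ht Hr].
    assert (Hu : Rbar_lt (exp (ln t)) (CV_radius a)) by now rewrite exp_ln.
    assert (P := centered_moment_0_pos a (mean_f a t) _ Ha Hu).
    unfold normalized_moment. simpl. field. lra.
  - apply filterlim_ext_loc with (fun t => leibniz (fun j => normalized_cumulant a j t)
      (fun j => normalized_moment a j t) k 0 0).
    + revert Hin. apply filter_imp. intros t [Ht Hr].
      symmetry. now apply normalized_moment_recurrence.
    + replace (normal_moment (S k)) with
        (leibniz (fun j => if Nat.eqb j 1 then 1 else 0) normal_moment k 0 0).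
      * apply filterlim_leibniz with k; [exact HF|exact H| |lia].
        intros j Hj. apply IH. lia.
      * rewrite leibniz_indicator_1. destruct k as [|k]; [simpl; ring|].
        simpl pred. now rewrite Nat.add_0_r.
Qed.

Lemma near_normal_normalized a K d :
  in_class_K a -> 0 < d ->
  (forall k, filterlim (normalized_moment a k) (Rbar_at_left (CV_radius a))
    (locally (normal_moment k))) ->
  Rbar_at_left (CV_radius a) (fun t => near_normal K d (normalized_expectation a t)).
Proof.
  intros Ha Hd H. assert (HF := Rbar_at_left_filter (CV_radius a)).
  assert (Hin := Rbar_at_left_inside _ (proj2 (proj2 (proj2 Ha)))).
  assert (Hk : forall k, Rbar_at_left (CV_radius a) (fun t => forall v,
    normalized_expectation a t (fun x => x ^ k) v -> Rabs (v - normal_moment k) <= d)).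
  { intros k. assert (Hl := H k _ (locally_ball (normal_moment k) (mkposreal d Hd))).
    generalize (filter_and _ _ Hin Hl). apply filter_imp. intros t [[Ht Hr] Hb] v Hv.
    rewrite (expectation_unique _ _ _ _ (expectation_normalized a t Ha Ht Hr) Hv
      (normalized_expectation_pow a t k Ha Ht Hr)).
    left. exact Hb. }
  induction K as [|K IH].
  - generalize (Hk 0%nat). apply filter_imp. intros t Ht k Hk0.
    replace k with 0%nat by lia. exact Ht.
  - generalize (filter_and _ _ (Hk (S K)) IH). apply filter_imp. intros t [Ht IHt] k Hk0.
    destruct (Nat.eq_dec k (S K)) as [->|Hne]; [exact Ht|]. apply IHt. lia.
Qed.

Theorem theorem3p1 (a : nat -> R) :
  in_class_K a ->
  (forall k : nat, (3 <= k)%nat ->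
     filterlim
       (fun s => Derive_n (fulcrum a) k s /
                 Rpower (Derive_n (fulcrum a) 2 s) (INR k / 2))
       (Rbar_at_left (Rbar_ln (CV_radius a))) (locally 0)) ->
  gaussian a.
Proof.
  intros Ha H x P [e HP]. unfold filtermap.
  assert (HF := Rbar_at_left_filter (CV_radius a)).
  assert (Hin := Rbar_at_left_inside _ (proj2 (proj2 (proj2 Ha)))).
  assert (HM := filterlim_normalized_moment a Ha (filterlim_normalized_cumulant a Ha H)).
  (* On each side the error is below [4 h]: [h] from the comparison, [h] from the truncation and
     [2 h] from the shift of the threshold. *)
  assert (He := cond_pos e). set (h := e / 6). assert (Hh : 0 < h) by (unfold h; lra).
  (* Two comparisons, as each is one-sided: the normalized law takes the first role at threshold [x]
     for the upper bound, and the second role, again at [x], for the lower bound. *)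
  destruct (cdf_comparison x h h Hh Hh) as (K1 & d1 & Hd1 & C1).
  destruct (cdf_comparison (x - 2 * h) h h Hh Hh) as (K2 & d2 & Hd2 & C2).
  replace (x - 2 * h + 2 * h) with x in C2 by ring.
  assert (Htr : forall K d y, 0 < d -> exists M, 0 <= M /\ - M <= y <= M /\
    near_normal K d (truncated_normal M) /\
    Rabs (RInt normal_density (- M) y - std_normal_cdf y) < h).
  { intros K d y Hd.
    assert (L := is_lim_RInt_normal_density_left y). rewrite <- std_normal_cdf_eq in L.
    apply is_lim_spec in L.
    assert (B : Rbar_locally p_infty (fun M => Rabs y < M)) by now exists (Rabs y).
    destruct (filter_ex (F := Rbar_locally p_infty) _ (filter_and _ _ B
      (filter_and _ _ (near_normal_truncated K d Hd) (L (mkposreal h Hh)))))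
      as (M & BM & NM & LM).
    exists M. assert (A := Rabs_pos y). apply Rabs_lt_between in BM.
    repeat split; auto; lra. }
  generalize (filter_and _ _ Hin (filter_and _ _
    (near_normal_normalized a K1 d1 Ha Hd1 HM) (near_normal_normalized a K2 d2 Ha Hd2 HM))).
  apply filter_imp. intros t [[Ht Hr] [N1 N2]]. apply HP.
  assert (HE := expectation_normalized a t Ha Ht Hr).
  assert (Hp := fun y => normalized_expectation_below a t y Ha Ht Hr).
  change (Rabs (normalized_cdf a t x - std_normal_cdf x) < e).
  destruct (Htr K1 d1 (x + 2 * h) Hd1) as (M1 & M1p & M1x & NM1 & L1).
  destruct (Htr K2 d2 (x - 2 * h) Hd2) as (M2 & M2p & M2x & NM2 & L2).
  assert (U1 := C1 _ _ _ _ HE (expectation_truncated_normal M1 M1p) N1 NM1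
    (Hp x) (truncated_normal_below M1 _ M1x)).
  assert (U2 := C2 _ _ _ _ (expectation_truncated_normal M2 M2p) HE NM2 N2
    (truncated_normal_below M2 _ M2x) (Hp x)).
  assert (I1 := std_normal_cdf_increment x (2 * h)).
  assert (I2 := std_normal_cdf_increment (x - 2 * h) (2 * h)).
  replace (x - 2 * h + 2 * h) with x in I2 by ring.
  apply Rabs_lt_between in L1, L2. apply Rabs_lt_between. unfold h in *. lra.
Qed.
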